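(* In the single-index setting of the context, suppose the following smooth and bounded design condition holds with a constant $U$: $U<\infty$, $\sup_{\theta\in\Theta}\|\theta\|_1\le U$ and, for all $w\in\mathcal W$, $t\in\mathcal T$, $\gamma\in\Gamma$, each of $|m|,\|\nabla_\gamma m\|_\infty,|\nabla_tm|,\|\nabla_{\gamma t}m\|_\infty,\|\nabla_{\gamma\gamma}m\|_\infty,|\nabla_{tt}m|$ at $(w,t,\gamma)$ is at most $U$, and $|\Lambda_j(z,\gamma)|,\|\nabla_\gamma\Lambda_j(z,\gamma)\|_\infty,\|\nabla_{\gamma\gamma}\Lambda_j(z,\gamma)\|_\infty\le U$ for all $j\in\{1,\dots,p\}$. Let $$\tau_n=4kU^5\sqrt{\frac{2\log p}{n}}+2U^3\sqrt{\frac{2\log p}{n}}$$ and suppose $\tau_n=o(1)$. Then the sample Hessian $\nabla_{\theta\theta}\widehat Q(\theta,g_0)$ converges uniformly to $\nabla_{\theta\theta}Q(\theta,g_0)$: $$\sup_{\theta\in\mathbb B}\big\|\nabla_{\theta\theta}\widehat Q(\theta,g_0)-\nabla_{\theta\theta}Q(\theta,g_0)\big\|_\infty=O_P(\tau_n)=o_P(1).$$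
   Context: Setting. $W_1,\dots,W_n$ are i.i.d. copies of $W\in\mathcal W\subseteq\mathbb R^{\dim W}$; $Z$ is a subvector of $W$ with support $\mathcal Z$; $n\to\infty$ with $p$ and $k$ possibly growing. $m(w,t,\gamma):\mathcal W\times\mathbb R\times\mathbb R^d\to\mathbb R$ is a moment function, $\Lambda(z,\gamma):\mathcal Z\times\mathbb R^d\to\mathbb R^p$ a known index function, $g_0:\mathcal Z\to\mathbb R^d$ a nuisance function, and $\theta_0\in\mathbb R^p$ satisfies $\mathbb E[m(W,\Lambda(Z,g_0(Z))'\theta_0,g_0(Z))\mid Z=z]=0$ for all $z$. $\ell$ solves $\partial_t\ell(w,t,\gamma)=m(w,t,\gamma)$; $Q(\theta,g)=\mathbb E[\ell(W,\Lambda(Z,g(Z))'\theta,g(Z))]$ and $\widehat Q(\theta,g)=\frac1n\sum_{i=1}^n\ell(W_i,\Lambda(Z_i,g(Z_i))'\theta,g(Z_i))$. $T=\{j:\theta_{0,j}\ne0\}$, $k=|T|$, $\mathcal C(T;3)=\{\nu\in\mathbb R^p:\|\nu_{T^c}\|_1\le3\|\nu_T\|_1\}$ ($\nu_T,\nu_{T^c}$: $\nu$ with the coordinates outside $T$, resp. $T^c$, set to zero), and $\mathbb B=\{\theta\in\mathbb R^p:\theta=\theta_0+r\nu,\ r\in[0,1),\ \nu\in\mathcal C(T;3)\}$. For a matrix, $\|\cdot\|_\infty$ is the largest absolute entry. $\mathcal W$ is an open bounded set containing the support of $W$, $\mathcal T$ is an open set containing the support of $\Lambda(Z,g_0(Z))'\theta_0$,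 and $\Gamma$ is an open bounded set containing the support of $g(Z)$ for $g\in\mathcal G_n$, where $\mathcal G_n\ni g_0$ is the nuisance realization set. $\Theta$ is the parameter space.
   Formalization: The sup is over θ in B∩Θ (B alone is unbounded and the claim fails); 𝒯 is assumed to contain the support of the index at every point of the segment from θ0 to each such θ, not only at θ0; p≥2 is assumed, since τ_n=0 when p=1. *)

(* Defs.v *)
From HB Require Import structures.
From mathcomp Require Import all_boot all_order all_algebra.
From mathcomp Require Import all_classical all_reals all_analysis.

Set Implicit Arguments.
Unset Strict Implicit.
Unset Printing Implicit Defensive.

Import Order.TTheory GRing.Theory Num.Theory.
Import numFieldNormedType.Exports.

Local Open Scope classical_set_scope.
Local Open Scope ring_scope.

(* R^n with its Borel sigma-algebra; vectors are row vectors. *)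
Notation borel_rV R n := (g_sigma_algebraType (@open 'rV[R]_n)).

Section vectors.
Variables (R : realType) (n : nat).
Implicit Types (v u nu theta : 'rV[R]_n) (T : {set 'I_n}).

Definition dotv u v : R := \sum_j u ord0 j * v ord0 j.

Definition l1norm v : R := \sum_j `|v ord0 j|.

Definition restrict_coords T v : 'rV[R]_n :=
  \row_j (if j \in T then v ord0 j else 0).

Definition nonzero_coords v : {set 'I_n} := [set j | v ord0 j != 0]%SET.

Definition cone T (c : R) : set 'rV[R]_n :=
  [set nu | l1norm (restrict_coords (~: T)%SET nu)
            <= c * l1norm (restrict_coords T nu)].

Definition cone_nbhd theta0 : set 'rV[R]_n :=
  [set theta | exists r nu,
     [/\ 0 <= r < 1, cone (nonzero_coords theta0) 3 nu
       & theta = theta0 + r *: nu]].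

(* The norm `|A| of a matrix is its largest absolute entry (mx_norm). *)
Definition gradient (f : 'rV[R]_n -> R) v : 'rV[R]_n :=
  \row_j 'D_(delta_mx ord0 j) f v.

Definition hessian (f : 'rV[R]_n -> R) v : 'M[R]_n :=
  \matrix_(i, j) 'D_(delta_mx ord0 i) ('D_(delta_mx ord0 j) f) v.

Definition has_gradient (f : 'rV[R]_n -> R) v :=
  forall j, derivable f v (delta_mx ord0 j).

Definition has_hessian (f : 'rV[R]_n -> R) v :=
  forall i j, derivable ('D_(delta_mx ord0 j) f) v (delta_mx ord0 i).

End vectors.

Section probability_notions.
Variables (R : realType) (d : measure_display) (Om : measurableType d).
Variable P : probability Om R.

Definition rv_support (E : topologicalType) (X : Om -> E) : set E :=
  [set x | forall B : set E, open B -> B x -> (0 < P (X @^-1` B))%E].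

Definition iid_copies d' (E : measurableType d') (I : finType)
    (W : {RV P >-> E}) (X : I -> {RV P >-> E}) : Prop :=
  (forall i (A : set E), measurable A ->
     distribution P (X i) A = distribution P W A) /\
  (forall A : I -> set E, (forall i, measurable (A i)) ->
     P (\bigcap_(i in [set: I]) (X i @^-1` A i))
     = (\prod_i P (X i @^-1` A i))%E).

(* f is a version of z |-> E[Y | Z = z]. *)
Definition is_cond_expectation d' (E : measurableType d')
    (Y : Om -> R) (Z : Om -> E) (f : E -> R) : Prop :=
  [/\ P.-integrable setT (EFin \o Y),
      measurable_fun setT f
    & forall B : set E, measurable B ->
        (\int[P]_(om in Z @^-1` B) (Y om)%:E
         = \int[P]_(om in Z @^-1` B) (f (Z om))%:E)%E].

End probability_notions.

Section stochastic_orders.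
Variables (R : realType) (d : nat -> measure_display).
Variables (Om : forall n, measurableType (d n)).
Variables (P : forall n, probability (Om n) R).
Variable X : forall n, Om n -> \bar R.

(* X n may be a supremum over an uncountable set, so probabilities are taken as
   outer probabilities; mu_ext (P n) agrees with P n on measurable sets. *)
Definition bigO_P (a : nat -> R) : Prop :=
  forall e : R, 0 < e -> exists2 M : R, 0 < M &
    \forall n \near \oo,
      (mu_ext (P n) [set om | (M * a n)%:E < `|X om|] <= e%:E)%E.

Definition littleo_P1 : Prop :=
  forall e : R, 0 < e ->
    (fun n => mu_ext (P n) [set om : Om n | (e%:E < `|X om|)%E]) @ \oo --> 0%E.

End stochastic_orders.

(* All objects attached to sample size n. Everything may vary with n. *)
Record setting (R : realType) (n : nat) := Setting {
  dimW : nat;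
  dimZ : nat;
  dimg : nat;                                  (* d *)
  dimp : nat;                                  (* p *)
  zsel : 'I_dimZ -> 'I_dimW;                   (* coordinates of W forming Z *)
  calW : set 'rV[R]_dimW;
  calT : set R;
  Gam : set 'rV[R]_dimg;
  Theta : set 'rV[R]_dimp;
  Gn : set ('rV[R]_dimZ -> 'rV[R]_dimg);
  mom : 'rV[R]_dimW -> R -> 'rV[R]_dimg -> R;  (* m *)
  loss : 'rV[R]_dimW -> R -> 'rV[R]_dimg -> R; (* ell *)
  Lam : 'rV[R]_dimZ -> 'rV[R]_dimg -> 'rV[R]_dimp;
  g0 : 'rV[R]_dimZ -> 'rV[R]_dimg;
  theta0 : 'rV[R]_dimp;
  disp : measure_display;
  Om : measurableType disp;
  Pr : probability Om R;
  W : {RV Pr >-> borel_rV R dimW};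
  Ws : 'I_n -> {RV Pr >-> borel_rV R dimW}     (* W_1, ..., W_n *)
}.

Arguments zsel {R n} s.
Arguments calW {R n} s.
Arguments calT {R n} s.
Arguments Gam {R n} s.
Arguments Theta {R n} s.
Arguments Gn {R n} s.
Arguments mom {R n} s.
Arguments loss {R n} s.
Arguments Lam {R n} s.
Arguments g0 {R n} s.
Arguments theta0 {R n} s.
Arguments W {R n} s.
Arguments Ws {R n} s.

Section single_index.
Variables (R : realType) (n : nat) (S : setting R n).

Definition subvec (w : 'rV[R]_(dimW S)) : 'rV[R]_(dimZ S) :=
  colsub (zsel S) w.

Definition Zvec (om : Om S) : 'rV[R]_(dimZ S) := subvec (W S om).

Definition calZ : set 'rV[R]_(dimZ S) := rv_support (Pr S) Zvec.

Definition idx (theta : 'rV[R]_(dimp S))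
    (g : 'rV[R]_(dimZ S) -> 'rV[R]_(dimg S)) (z : 'rV[R]_(dimZ S)) : R :=
  dotv (Lam S z (g z)) theta.

Definition loss_at (theta : 'rV[R]_(dimp S))
    (g : 'rV[R]_(dimZ S) -> 'rV[R]_(dimg S)) (w : 'rV[R]_(dimW S)) : R :=
  loss S w (idx theta g (subvec w)) (g (subvec w)).

Definition Qpop theta g : R :=
  fine ('E_(Pr S)[fun om => loss_at theta g (W S om)])%E.

Definition Qhat (om : Om S) theta g : R :=
  n%:R^-1 * \sum_(i < n) loss_at theta g (Ws S i om).

Definition sparsity : nat := #|nonzero_coords (theta0 S)|.

(* cone_nbhd is a translated cone, hence unbounded as soon as theta0 != 0; it
   is intersected with the parameter space, on which smooth_bounded_design
   bounds the l1 norm. *)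
Definition BTheta : set 'rV[R]_(dimp S) := cone_nbhd (theta0 S) `&` Theta S.

Definition hessian_deviation (om : Om S) : \bar R :=
  ereal_sup [set (`|hessian (fun th => Qhat om th (g0 S)) theta
                    - hessian (fun th => Qpop th (g0 S)) theta|)%:E
            | theta in BTheta].

Definition sample_setting : Prop :=
  [/\ injective (zsel S), iid_copies (W S) (Ws S), Gn S (g0 S)
    & Theta S (theta0 S)].

Definition moment_restriction : Prop :=
  is_cond_expectation (Pr S)
    (fun om => mom S (W S om) (idx (theta0 S) (g0 S) (Zvec om)) (g0 S (Zvec om)))
    (Zvec : Om S -> borel_rV R (dimZ S)) (cst 0).

Definition loss_antiderivative : Prop :=
  forall w (t : R) gam, calW S w ->
    is_derive t (1 : R) (fun s : R => loss S w s gam) (mom S w t gam).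

Definition domain_setting : Prop :=
  [/\ [/\ open (calW S), bounded_set (calW S)
         & rv_support (Pr S) (fun om => W S om : 'rV[R]_(dimW S))
             `<=` calW S],
      [/\ open (Gam S), bounded_set (Gam S)
         & forall g, Gn S g -> rv_support (Pr S) (g \o Zvec) `<=` Gam S]
    & open (calT S) /\
      rv_support (Pr S) (fun om => idx (theta0 S) (g0 S) (Zvec om))
        `<=` calT S].

Definition single_index_setting : Prop :=
  [/\ sample_setting, moment_restriction, loss_antiderivative
    & domain_setting].

(* The index at (theta, g0), and along the segment from theta0 to theta, stays in
   the domain calT on which m is smooth. Without the segment, bounds on the
   t-derivatives over a disconnected calT would not control the variation of
   nabla_t m between theta0 and theta. Implied by calT being an interval, or
   by Theta being convex, once calT contains the support of the index at each
   theta in BTheta. *)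
Definition index_domain : Prop :=
  forall theta r, BTheta theta -> 0 <= r <= 1 ->
    rv_support (Pr S) (fun om =>
        idx (theta0 S + r *: (theta - theta0 S)) (g0 S) (Zvec om))
      `<=` calT S.

(* Measurability of the primitives and existence of Q at g0. *)
Definition regular_setting : Prop :=
  [/\ measurable_fun setT
        (fun x : borel_rV R (dimW S) * R * borel_rV R (dimg S) =>
           mom S x.1.1 x.1.2 x.2),
      measurable_fun setT
        (fun x : borel_rV R (dimW S) * R * borel_rV R (dimg S) =>
           loss S x.1.1 x.1.2 x.2),
      measurable_fun setT
        (fun x : borel_rV R (dimZ S) * borel_rV R (dimg S) =>
           (Lam S x.1 x.2 : borel_rV R (dimp S))),
      (forall g, Gn S g ->
         measurable_fun setT
           (g : borel_rV R (dimZ S) -> borel_rV R (dimg S)))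
    & forall theta, BTheta theta ->
        (Pr S).-integrable setT
          (EFin \o (fun om => loss_at theta (g0 S) (W S om)))].

Definition smooth_bounded_moment (U : R) (w : 'rV[R]_(dimW S)) (t : R)
    (gam : 'rV[R]_(dimg S)) : Prop :=
  let dt_mom (s : R) c : R := derive1 (fun s' : R => mom S w s' c) s in
  [/\ `|mom S w t gam| <= U,
      has_gradient (mom S w t) gam /\ `|gradient (mom S w t) gam| <= U,
      derivable (fun s : R => mom S w s gam) t (1 : R) /\ `|dt_mom t gam| <= U,
      has_gradient (dt_mom t) gam /\ `|gradient (dt_mom t) gam| <= U
    & (has_hessian (mom S w t) gam /\ `|hessian (mom S w t) gam| <= U) /\
      (derivable (fun s : R => dt_mom s gam) t (1 : R) /\
       `|derive1 (fun s : R => dt_mom s gam) t| <= U)].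

Definition smooth_bounded_index (U : R) (z : 'rV[R]_(dimZ S))
    (gam : 'rV[R]_(dimg S)) (j : 'I_(dimp S)) : Prop :=
  let Lamj c := Lam S z c ord0 j in
  [/\ `|Lamj gam| <= U,
      has_gradient Lamj gam /\ `|gradient Lamj gam| <= U
    & has_hessian Lamj gam /\ `|hessian Lamj gam| <= U].

Definition smooth_bounded_design (U : R) : Prop :=
  [/\ (forall theta, Theta S theta -> l1norm theta <= U),
      (forall w t gam, calW S w -> calT S t -> Gam S gam ->
         smooth_bounded_moment U w t gam)
    & forall z gam, calZ z -> Gam S gam ->
        forall j, smooth_bounded_index U z gam j].

Definition tau (U : R) : R :=
  4 * sparsity%:R * U ^+ 5 * Num.sqrt (2 * ln (dimp S)%:R / n%:R)
  + 2 * U ^+ 3 * Num.sqrt (2 * ln (dimp S)%:R / n%:R).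

End single_index.

(* Main.v *)
Require Import Defs.
From HB Require Import structures.
From mathcomp Require Import all_boot all_order all_algebra.
From mathcomp Require Import all_classical all_reals all_analysis.
From mathcomp Require Import measurable_realfun.
From mathcomp Require Import ring lra.

Set Implicit Arguments.
Unset Strict Implicit.
Unset Printing Implicit Defensive.

Import Order.TTheory GRing.Theory Num.Theory.
Import numFieldNormedType.Exports.

Local Open Scope classical_set_scope.
Local Open Scope ring_scope.

(** The proof.  Almost surely every observation lies in the support of the
    design, where both Hessians are explicit: with L = Lambda(z, g0 z) and

      h_th(w) = d_t m(w, <L, th>, g0 z) L_a L_b,

    entry (a, b) of the sample Hessian is the average of h_th over the sample
    [hessian_Qhat], and that of the population Hessian is the expectation of
    h_th(W) [hessian_Qpop].  The deviation to be bounded is thus the supremum,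
    over th in B and over the p^2 entries, of an empirical process.

    For a fixed entry, h_th varies with th only through the linear index:
    |h_th - h_th'| <= U^3 |<L, th - th'>| [hessian_entry_lipschitz].  Hence the
    increments h_th - h_th0 are contractions of a process that is linear in
    th - th0, whose supremum over an l1 ball is at most the radius times the
    largest of its p coordinates.  This gives the exponential inequality
    [uniform_deviation] with a factor p in front, in which the radius of the
    l1 ball (at most 2 k U, [l1norm_BTheta]), the Lipschitz constant U^3 and
    the bound U on L multiply up to 2 k U^5.  The single function h_th0 is
    bounded by U^3.  With K = 2 k U^5 + U^3, tau_n is
    2 K sqrt(2 ln p / n); a union bound over the p^2 entries shows that the
    deviation exceeds M tau_n with probability at most
    8 p^3 exp(- M^2 ln p / 64) [hessian_deviation_tau_tail], which is small
    for M large, uniformly in n because p >= 2.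

    The inequality [uniform_deviation] is proved by exponential moments:
    symmetrization one observation at a time [symmetrization_step], the
    Ledoux-Talagrand contraction principle for the exponential
    [expmax_contraction], and the sub-Gaussian bound for Rademacher sums.
    These steps are carried out for observations in a finite alphabet, where
    expectations are finite sums; rounding the functions on a finite
    measurable partition [finite_quantization] transfers the result to
    arbitrary observations, independence entering through the probabilities of
    the cylinders of that partition [cylinder_prob].

    Two points need care because B is uncountable.  The exceptional null event
    must not depend on th, so it is defined through the support of the vector
    L rather than through the supports of the indices <L, th>; and the
    supremum is reduced to a dense sequence of B, along which the deviation is
    Lipschitz. *)

(** * Contraction for the maximum of exponentials *)

Section expmax.
Variables (R : realType) (I : finType).
Implicit Types (A f g : I -> R) (y : R).

(** The exponential of max_i A_i; the value 0 on an empty index type keeps the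
    lemmas below free of inhabitation hypotheses. *)
Definition expmax A : R := \big[Num.max/0]_i expR (A i).

Lemma expmax_ge A i : expR (A i) <= expmax A.
Proof. exact: le_bigmax. Qed.

Lemma expmax_ge0 A : 0 <= expmax A.
Proof. exact: bigmax_ge_id. Qed.

Lemma expmax_le A y : 0 <= y -> (forall i, expR (A i) <= y) -> expmax A <= y.
Proof. by move=> y0 Ay; apply: bigmax_le. Qed.

Lemma expmax_arg A (i0 : I) :
  exists2 i, expmax A = expR (A i) & forall j, A j <= A i.
Proof.
exists [arg max_(i > i0) A i]%O.
  apply/eqP; rewrite eq_le expmax_ge andbT; apply: expmax_le => [|i].
    exact: expR_ge0.
  by rewrite ler_expR; case: arg_maxP => // j _; apply.
by case: arg_maxP => // j _ jA i; exact: jA.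
Qed.

(** Convexity and monotonicity of the exponential: its increments grow with
    the base point and with the width. *)
Lemma expR_shift_le (x y w z : R) : x <= y -> 0 <= w -> w <= z ->
  expR (x + w) - expR x <= expR (y + z) - expR y.
Proof.
move=> xy w0 wz.
have e0 : 0 <= expR w - 1 by rewrite subr_ge0 -expR0 ler_expR.
have e1 : expR w - 1 <= expR z - 1 by rewrite lerD2r ler_expR.
have -> : expR (x + w) - expR x = expR x * (expR w - 1) by rewrite expRD; ring.
have -> : expR (y + z) - expR y = expR y * (expR z - 1) by rewrite expRD; ring.
by apply: ler_pM => //; rewrite ?expR_ge0// ler_expR.
Qed.

(** One coordinate of the Ledoux-Talagrand contraction principle: the two terms
    on each side are the values at a Rademacher sign +1 and -1.  If s maximizes
    A + f and t maximizes A - f, then the left-hand side is attained at the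
    pair (s, t), and it suffices to find a pair that does as well for g: either
    (s, t) or (t, s) works, according to the signs and sizes of g s and g t. *)
Lemma expmax_contraction A f g :
  (forall i, `|f i| <= `|g i|) ->
  (forall i j, `|f i - f j| <= `|g i - g j|) ->
  expmax (A \+ f) + expmax (A \- f) <= expmax (A \+ g) + expmax (A \- g).
Proof.
move=> fg fgB.
have [i0 _|I0] := pickP (fun _ : I => true); last first.
  have e B : expmax B = 0 by rewrite /expmax big_pred0.
  by rewrite !e.
have [s -> sA] := expmax_arg (A \+ f) i0.
have [t -> tA] := expmax_arg (A \- f) i0.
have := sA t; have := tA s; rewrite /= => {}tA {}sA.
have gp h : expR (A s + h s) + expR (A t - h t) <=
    expmax (A \+ h) + expmax (A \- h).
  by apply: lerD; [exact: (expmax_ge (A \+ h))|exact: (expmax_ge (A \- h))].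
have gm h : expR (A t + h t) + expR (A s - h s) <=
    expmax (A \+ h) + expmax (A \- h).
  by apply: lerD; [exact: (expmax_ge (A \+ h))|exact: (expmax_ge (A \- h))].
have sym h : expmax (A \+ (\- h)) + expmax (A \- (\- h)) =
    expmax (A \+ h) + expmax (A \- h).
  rewrite addrC; congr (_ + expmax _).
  by congr expmax; apply/funext => i /=; rewrite opprK.
(* Up to replacing g by - g, which exchanges the two terms on the right, one may
   assume 0 <= g s. *)
have key (h : I -> R) : (forall i, `|f i| <= `|h i|) ->
    (forall i j, `|f i - f j| <= `|h i - h j|) -> 0 <= h s ->
    expR (A s + f s) + expR (A t - f t) <=
    expmax (A \+ h) + expmax (A \- h).
  move=> fh fhB hs; have := fh s; have := fh t; have := fhB s t.
  rewrite (ger0_norm hs) !ler_norml.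
  have [ht|ht] := leP 0 (h t); last first.
    rewrite (ltr0_norm ht) => _ /andP[ft1 ft2] /andP[fs1 fs2].
    by apply: le_trans (gp h); apply: lerD; rewrite ler_expR; lra.
  rewrite (ger0_norm ht).
  have [st|st] := leP (h t) (h s).
  - rewrite [`|h s - h t|]ger0_norm ?subr_ge0// => /andP[b1 b2] /andP[t1 t2] /andP[s1 s2].
    apply: le_trans (gp h).
    have := @expR_shift_le (A t - h t) (A s + f s) (h t - f t) (h s - f s).
    have -> : A t - h t + (h t - f t) = A t - f t by ring.
    have -> : A s + f s + (h s - f s) = A s + h s by ring.
    move=> H; have : expR (A t - f t) - expR (A t - h t) <=
      expR (A s + h s) - expR (A s + f s) by apply: H; lra.
    by move: (expR _) (expR _) (expR _) (expR _) => *; lra.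
  - rewrite [`|h s - h t|]ltr0_norm ?subr_lt0// => /andP[b1 b2] /andP[t1 t2] /andP[s1 s2].
    apply: le_trans (gm h).
    have := @expR_shift_le (A s - h s) (A t - f t) (h s + f s) (h t + f t).
    have -> : A s - h s + (h s + f s) = A s + f s by ring.
    have -> : A t - f t + (h t + f t) = A t + h t by ring.
    move=> H; have : expR (A s + f s) - expR (A s - h s) <=
      expR (A t + h t) - expR (A t - f t) by apply: H; lra.
    by move: (expR _) (expR _) (expR _) (expR _) => *; lra.
have [gs|/ltW gs] := leP 0 (g s); first exact: key.
rewrite -(sym g); apply: key => [i|i j|] /=.
- by rewrite normrN.
- by rewrite -opprD normrN.
- by rewrite oppr_ge0.
Qed.

End expmax.

(** * Symmetrization over a finite alphabet *)

(** A sub-Gaussian bound for cosh with a crude constant: for z >= 1/2 because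
    z <= 2 z^2, and for z < 1/2 because e^u <= 1 / (1 - u) makes the sum at most
    2 / (1 - z^2). *)
Lemma expRDexpRN_le (R : realType) (z : R) :
  expR z + expR (- z) <= 2 * expR (2 * z ^+ 2).
Proof.
wlog z0 : z / 0 <= z.
  move=> h; have [/h//|/ltW] := leP 0 z.
  by rewrite -oppr_ge0 => /h; rewrite opprK sqrrN addrC.
have [z2|z2] := leP (1 / 2) z.
  have h1 : expR z <= expR (2 * z ^+ 2) by rewrite ler_expR; nra.
  have h2 : expR (- z) <= expR (2 * z ^+ 2) by rewrite ler_expR; nra.
  by lra.
have inv (u : R) : u < 1 -> expR u <= (1 - u)^-1.
  move=> u1; rewrite -[expR u]invrK -expRN lef_pV2 ?posrE ?expR_gt0 ?subr_gt0//.
  exact: expR_ge1Dx.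
have h1 : expR z <= (1 - z)^-1 by apply: inv; lra.
have h2 : expR (- z) <= (1 + z)^-1 by have := inv (- z); rewrite opprK; apply; lra.
have h3 := expR_ge1Dx (2 * z ^+ 2).
apply: (@le_trans _ _ (2 * (1 + 2 * z ^+ 2))); last by rewrite ler_pM2l.
apply: (le_trans (lerD h1 h2)).
have zz : z ^+ 2 <= 1 / 4.
  by rewrite expr2; apply: (@le_trans _ _ (1 / 2 * z)); [apply: ler_wpM2r; lra|lra].
have -> : (1 - z)^-1 + (1 + z)^-1 = 2 / (1 - z ^+ 2) :> R.
  field; apply/and3P; split; apply: lt0r_neq0; lra.
rewrite ler_pdivrMr; last lra.
have : 0 <= z ^+ 2 * (1 - 2 * z ^+ 2) by apply: mulr_ge0; [exact: sqr_ge0|lra].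
by move: (z ^+ 2) => u *; lra.
Qed.

Section finite_symmetrization.
Variables (R : realType) (I C : finType) (q : C -> R).
Hypotheses (q_ge0 : forall c, 0 <= q c) (q_sum1 : \sum_c q c = 1).
Implicit Types (A : I -> R) (f g : C -> I -> R) (G H : (I -> R) -> R).

(** Integrates one more observation out of an exponential moment: [G A] is the
    moment when the remaining observations have contributed A to the process.
    Iterating this operator from [expmax] gives the exponential moment of the
    maximum of the centered sums, see [tuple_mean_iter]. *)
Definition centered_step f G A : R :=
  \sum_c q c * G (fun i => A i + (f c i - \sum_c' q c' * f c' i)).

(** The analogue of [centered_step] for the process in which the centered
    summand is replaced by twice a Rademacher multiple of g. *)
Definition sign_step g G A : R :=
  \sum_c q c * ((G (fun i => A i + 2 * g c i)
                 + G (fun i => A i - 2 * g c i)) / 2).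

Lemma centered_step_le f G H : (forall A, G A <= H A) ->
  forall A, centered_step f G A <= centered_step f H A.
Proof. by move=> GH A; apply: ler_sum => c _; apply: ler_wpM2l. Qed.

Lemma sign_step_le g G H : (forall A, G A <= H A) ->
  forall A, sign_step g G A <= sign_step g H A.
Proof.
move=> GH A; apply: ler_sum => c _; apply: ler_wpM2l => //.
by apply: ler_wpM2r; rewrite ?invr_ge0//; apply: lerD.
Qed.

(** Both operators are mixtures of translations of the state A, which commute;
    this is what allows the observations to be symmetrized one at a time. *)
Lemma centered_sign_comm f g G A :
  centered_step f (sign_step g G) A = sign_step g (centered_step f G) A.
Proof.
rewrite /centered_step /sign_step.
under eq_bigr do rewrite mulr_sumr.
rewrite exchange_big/=; apply: eq_bigr => c _.
rewrite -big_split/= mulr_suml mulr_sumr; apply: eq_bigr => c' _.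
rewrite mulrCA; congr (_ * _); rewrite mulrA -mulrDr; congr (_ * (_ + _) / 2).
- by congr G; apply/funext => i; ring.
- by congr G; apply/funext => i; ring.
Qed.

(** Jensen for the exponential, from its tangent at the mean. *)
Lemma mean_expR_ge (x : C -> R) :
  expR (- \sum_c q c * x c) <= \sum_c q c * expR (- x c).
Proof.
set m := \sum_c _.
have h c : expR (- m) * (1 + (m - x c)) <= expR (- x c).
  rewrite [leRHS](_ : _ = expR (- m) * expR (m - x c)); last first.
    by rewrite -expRD; congr expR; ring.
  by rewrite ler_wpM2l ?expR_ge0// expR_ge1Dx.
have -> : expR (- m) = \sum_c q c * (expR (- m) * (1 + (m - x c))).
  rewrite (eq_bigr (fun c => expR (- m) * (1 + m) * q c
                             - expR (- m) * (q c * x c))); last first.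
    by move=> c _; ring.
  by rewrite sumrB -!mulr_sumr q_sum1 -/m; ring.
by apply: ler_sum => c _; rewrite ler_wpM2l.
Qed.

(** Jensen replaces the mean of f by the value at an independent copy c'; the
    inequality 2 e^(x + y) <= e^(2 x) + e^(2 y) then separates c from c' at
    the cost of a factor 2 in the exponent, and contraction passes from f to
    g. *)
Lemma symmetrization_step f g :
  (forall c i, `|f c i| <= `|g c i|) ->
  (forall c i j, `|f c i - f c j| <= `|g c i - g c j|) ->
  forall A, centered_step f (@expmax R I) A <= sign_step g (@expmax R I) A.
Proof.
move=> fg fgB A; rewrite /centered_step /sign_step.
(* Jensen against an independent copy c' of c. *)
have jensen c : expmax (fun i => A i + (f c i - \sum_c' q c' * f c' i)) <=
    \sum_c' q c' * expmax (fun i => A i + (f c i - f c' i)).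
  apply: expmax_le => [|i].
    by apply: sumr_ge0 => c' _; rewrite mulr_ge0// expmax_ge0.
  rewrite addrA expRD.
  apply: (@le_trans _ _
    (expR (A i + f c i) * \sum_c' q c' * expR (- f c' i))).
    by rewrite ler_wpM2l ?expR_ge0// mean_expR_ge.
  rewrite mulr_sumr; apply: ler_sum => c' _.
  rewrite mulrCA ler_wpM2l// -expRD -addrA.
  exact: (expmax_ge (fun i => A i + (f c i - f c' i))).
(* The geometric mean of the two signed terms is below their arithmetic one. *)
have agm c c' : expmax (fun i => A i + (f c i - f c' i)) <=
    (expmax (fun i => A i + 2 * f c i) + expmax (fun i => A i - 2 * f c' i)) / 2.
  apply: expmax_le => [|i]; first by rewrite divr_ge0// addr_ge0// expmax_ge0.
  have := expmax_ge (fun i => A i + 2 * f c i) i.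
  have := expmax_ge (fun i => A i - 2 * f c' i) i.
  move: (expmax _) (expmax _) => X Y.
  rewrite /= (_ : A i + 2 * f c i = (A i / 2 + f c i) + (A i / 2 + f c i));
    last by field.
  rewrite (_ : A i - 2 * f c' i = (A i / 2 - f c' i) + (A i / 2 - f c' i));
    last by field.
  rewrite (_ : A i + (f c i - f c' i) = (A i / 2 + f c i) + (A i / 2 - f c' i));
    last by field.
  move: (A i / 2 + f c i) (A i / 2 - f c' i) => a b; rewrite !expRD => ha hb.
  rewrite ler_pdivlMr//.
  by have := sqr_ge0 (expR a - expR b); rewrite sqrrB !expr2; lra.
have mean2 (X Y : C -> R) :
    \sum_c q c * (\sum_c' q c' * ((X c + Y c') / 2)) =
    \sum_c q c * ((X c + Y c) / 2).
  transitivity (\sum_c (q c * (X c / 2) + q c * (\sum_c' q c' * (Y c' / 2)))).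
    apply: eq_bigr => c _; rewrite -mulrDr; congr (_ * _).
    rewrite -[X c / 2]mul1r -q_sum1 mulr_suml -big_split/=.
    by apply: eq_bigr => c' _; ring.
  rewrite big_split/= -mulr_suml q_sum1 mul1r -big_split/=.
  by apply: eq_bigr => c _; ring.
apply: (@le_trans _ _ (\sum_c q c * \sum_c' q c' *
    ((expmax (fun i => A i + 2 * f c i)
      + expmax (fun i => A i - 2 * f c' i)) / 2))).
  apply: ler_sum => c _; rewrite ler_wpM2l//; apply: (le_trans (jensen c)).
  by apply: ler_sum => c' _; rewrite ler_wpM2l.
rewrite mean2; apply: ler_sum => c _; rewrite ler_wpM2l// ler_wpM2r ?invr_ge0//.
apply: (@expmax_contraction R I A (fun i => 2 * f c i) (fun i => 2 * g c i)).
  by move=> i; rewrite !normrM ler_wpM2l.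
by move=> i j; rewrite -!mulrBr !normrM ler_wpM2l.
Qed.

Lemma iter_symmetrization f g n :
  (forall c i, `|f c i| <= `|g c i|) ->
  (forall c i j, `|f c i - f c j| <= `|g c i - g c j|) ->
  forall A, iter n (centered_step f) (@expmax R I) A <=
            iter n (sign_step g) (@expmax R I) A.
Proof.
move=> fg fgB; elim: n => [//|n IH] A; rewrite !iterS.
have comm B : centered_step f (iter n (sign_step g) (@expmax R I)) B =
    iter n (sign_step g) (centered_step f (@expmax R I)) B.
  elim: (n) B => [//|m IHm] B; rewrite !iterS centered_sign_comm.
  by apply: eq_bigr => c _; rewrite !IHm.
apply: (le_trans (centered_step_le f IH A)); rewrite comm -iterS iterSr.
elim: (n) A => [|m IHm] A; first exact: symmetrization_step.
by rewrite !iterS; apply: sign_step_le.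
Qed.

(** The expectation of F at n independent letters with law q. *)
Definition tuple_mean n (F : n.-tuple C -> R) : R :=
  \sum_(a : n.-tuple C) (\prod_(k < n) q (tnth a k)) * F a.

Lemma tuple_meanS n (F : n.+1.-tuple C -> R) :
  tuple_mean F = \sum_c q c * tuple_mean (fun a => F [tuple of c :: a]).
Proof.
rewrite /tuple_mean.
under [RHS]eq_bigr do rewrite mulr_sumr.
rewrite pair_bigA/=.
rewrite (reindex (fun x : C * n.-tuple C => [tuple of x.1 :: x.2]))/=; last first.
  exists (fun a : n.+1.-tuple C => (thead a, [tuple of behead a])).
    by move=> [c a] _ /=; rewrite theadE; congr pair; apply/val_inj.
  by move=> a _ /=; rewrite -tuple_eta.
apply: eq_bigr => -[c a] _ /=; rewrite big_ord_recl tnth0 mulrA; congr (_ * _ * _).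
by apply: eq_bigr => k _; rewrite tnthS.
Qed.

Lemma tuple_mean_iter f n G A :
  tuple_mean (fun a : n.-tuple C =>
    G (fun i => A i + \sum_(k < n) (f (tnth a k) i - \sum_c q c * f c i)))
  = iter n (centered_step f) G A.
Proof.
elim: n A => [|n IH] A.
  rewrite /tuple_mean (big_pred1 [tuple]) ?big_ord0 ?mul1r/=; last first.
    by move=> a; apply/esym/eqP; exact: tuple0.
  by congr G; apply/funext => i; rewrite big_ord0 addr0.
rewrite tuple_meanS iterS; apply: eq_bigr => c _; congr (_ * _).
rewrite -IH; apply: eq_bigr => a _; congr (_ * G _); apply/funext => i.
rewrite big_ord_recl tnth0 addrA; congr (_ + _).
by apply: eq_bigr => k _; rewrite tnthS.
Qed.

Section linear.
Variables (p : nat) (x : I -> 'I_p -> R) (v : C -> 'I_p -> R) (B V K : R).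
Hypotheses (xB : forall i, \sum_j `|x i j| <= B) (vV : forall c j, `|v c j| <= V)
  (B0 : 0 <= B) (BVK : B * V <= K) (p0 : (0 < p)%N).

Let lin (y : 'I_p -> R) : I -> R := fun i => \sum_j x i j * y j.

Let H (y : 'I_p -> R) : R := \sum_j (expR (B * y j) + expR (- (B * y j))).

(** A linear form with coefficients of l1 norm at most B is at most B times the
    largest entry in absolute value; the sum over the entries replaces their
    maximum so that the bound factorizes under [sign_step]. *)
Lemma expmax_lin_le y : expmax (lin y) <= H y.
Proof.
have H0 : 0 <= H y by apply: sumr_ge0 => j _; rewrite addr_ge0// expR_ge0.
apply: expmax_le => // i.
set j0 := [arg max_(j > Ordinal p0) `|y j|]%O.
have jmax j : `|y j| <= `|y j0| by rewrite /j0; case: arg_maxP => // k _; apply.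
have le1 : lin y i <= B * `|y j0|.
  apply: (@le_trans _ _ (\sum_j `|x i j| * `|y j0|)).
    apply: ler_sum => j _; apply: (le_trans (ler_norm _)).
    by rewrite normrM ler_wpM2l.
  by rewrite -mulr_suml ler_wpM2r.
apply: (@le_trans _ _ (expR (B * `|y j0|))); first by rewrite ler_expR.
rewrite /H (bigD1 j0)//= ler_wpDr//.
  by apply: sumr_ge0 => j _; rewrite addr_ge0// expR_ge0.
have [y0|y0] := leP 0 (y j0).
  by rewrite ger0_norm// lerDl expR_ge0.
by rewrite ltr0_norm// mulrN lerDr expR_ge0.
Qed.

(** Each step multiplies the two exponentials of the j-th entry by
    cosh (2 B v_j), with |B v_j| <= K. *)
Lemma iter_sign_step_le n y :
  iter n (sign_step (fun c => lin (v c))) (@expmax R I) (lin y) <=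
  expR (8 * K ^+ 2) ^+ n * H y.
Proof.
elim: n y => [|n IH] y; first by rewrite expr0 mul1r expmax_lin_le.
rewrite iterS /sign_step.
have linD c s : (fun i => lin y i + s * lin (v c) i) =
    lin (fun j => y j + s * v c j).
  apply/funext => i; rewrite /lin mulr_sumr -big_split/=.
  by apply: eq_bigr => j _; ring.
have linB c : (fun i => lin y i - 2 * lin (v c) i) =
    lin (fun j => y j + - 2 * v c j).
  by rewrite -linD; apply/funext => i; rewrite mulNr.
under eq_bigr do rewrite linB linD.
rewrite exprS [_ * expR _ ^+ _]mulrC -mulrA.
apply: (@le_trans _ _ (\sum_c q c *
    (expR (8 * K ^+ 2) ^+ n * (expR (8 * K ^+ 2) * H y)))); last first.
  by rewrite -mulr_suml q_sum1 mul1r.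
apply: ler_sum => c _; rewrite ler_wpM2l// ler_pdivrMr//.
apply: (le_trans (lerD (IH _) (IH _))); rewrite -mulrDr -mulrA.
rewrite ler_wpM2l ?exprn_ge0 ?expR_ge0// -big_split/= mulr_sumr mulr_suml.
apply: ler_sum => j _.
set a := B * y j; set b := B * (2 * v c j).
have -> : B * (y j + 2 * v c j) = a + b by rewrite /a /b; ring.
have -> : B * (y j + - 2 * v c j) = a - b by rewrite /a /b; ring.
rewrite !opprD opprK !expRD.
have bK : `|b| <= 2 * K.
  rewrite /b !normrM (ger0_norm B0) ger0_norm//.
  have : B * `|v c j| <= B * V by rewrite ler_wpM2l.
  by move: BVK; lra.
have := expRDexpRN_le b.
have : expR (2 * b ^+ 2) <= expR (8 * K ^+ 2).
  rewrite ler_expR -(real_normK (num_real b)).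
  have : `|b| ^+ 2 <= (2 * K) ^+ 2 by rewrite lerXn2r// nnegrE (le_trans _ bK).
  by rewrite exprMn; lra.
have := expR_ge0 a; have := expR_ge0 (- a).
move: (expR a) (expR (- a)) (expR b) (expR (- b)) => ea ea' eb eb' *.
have -> : ea * eb + ea' * eb' + (ea * eb' + ea' * eb) = (ea + ea') * (eb + eb').
  by ring.
rewrite [leRHS](_ : _ = (ea + ea') * (2 * expR (8 * K ^+ 2))); last by ring.
by apply: ler_wpM2l; lra.
Qed.

End linear.
End finite_symmetrization.

(** * Exponential tail bounds over a finite alphabet *)

Section finite_tail.
Variables (R : realType) (I C : finType) (q : C -> R).
Hypotheses (q_ge0 : forall c, 0 <= q c) (q_sum1 : \sum_c q c = 1).
Variables (p : nat) (x : I -> 'I_p -> R) (v : C -> 'I_p -> R).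
Variables (B V K : R).
Hypotheses (xB : forall i, \sum_j `|x i j| <= B) (vV : forall c j, `|v c j| <= V)
  (B0 : 0 <= B) (BVK : B * V <= K) (K0 : 0 < K)
  (p0 : (0 < p)%N).

Let weight n (a : n.-tuple C) : R := \prod_(k < n) q (tnth a k).

(** Chernoff's bound, applied to the maximum over the family. *)
Lemma upper_tail (f : C -> I -> R) n (t : R) : 0 < t ->
  (forall c i, `|f c i| <= `|\sum_j x i j * v c j|) ->
  (forall c i i', `|f c i - f c i'| <=
     `|\sum_j x i j * v c j - \sum_j x i' j * v c j|) ->
  \sum_(a : n.-tuple C |
      [exists i, n%:R * t < \sum_(k < n) (f (tnth a k) i - \sum_c q c * f c i)])
     weight a
  <= 2 * p%:R * expR (- (n%:R * t ^+ 2 / (32 * K ^+ 2))).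
Proof.
move=> t0 fg fgB.
(* The minimiser of 8 n K^2 l^2 - l n t. *)
set l := t / (16 * K ^+ 2).
have K2 : 0 < K ^+ 2 by rewrite exprn_gt0.
have l0 : 0 < l by rewrite divr_gt0// mulr_gt0.
have w0 n' (a : n'.-tuple C) : 0 <= weight a by exact: prodr_ge0.
pose S (a : n.-tuple C) (i : I) :=
  \sum_(k < n) (f (tnth a k) i - \sum_c q c * f c i).
pose lf c i := l * f c i.
apply: (@le_trans _ _ (\sum_(a : n.-tuple C)
    weight a * (expmax (fun i => 0 + \sum_(k < n) (lf (tnth a k) i
      - \sum_c q c * lf c i)) * expR (- (l * (n%:R * t)))))).
  rewrite big_mkcond; apply: ler_sum => a _; case: ifPn => [|_]; last first.
    by rewrite mulr_ge0// mulr_ge0 ?expmax_ge0 ?expR_ge0.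
  move=> /existsP[i Hi]; rewrite ler_peMr//.
  rewrite expRN -[leRHS]/(_ / _) ler_pdivlMr ?expR_gt0// mul1r.
  apply: le_trans (expmax_ge _ i); rewrite ler_expR add0r.
  rewrite (eq_bigr (fun k => l * (f (tnth a k) i - \sum_c q c * f c i))).
    by rewrite -mulr_sumr ler_pM2l// ltW.
  move=> k _; rewrite /lf mulrBr; congr (_ - _).
  by rewrite mulr_sumr; apply: eq_bigr => c _; rewrite mulrCA.
under eq_bigr do rewrite mulrA.
rewrite -mulr_suml.
rewrite [X in X * _](_ : _ = iter n (centered_step q lf) (@expmax R I) (fun=> 0));
  last exact: tuple_mean_iter.
pose lx i j := l * x i j.
have linl c i : \sum_j lx i j * v c j = l * \sum_j x i j * v c j.
  by rewrite mulr_sumr; apply: eq_bigr => j _; rewrite mulrA.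
have sym := @iter_symmetrization R I C q q_ge0 q_sum1 lf
  (fun c i => \sum_j lx i j * v c j) n.
have {}sym : iter n (centered_step q lf) (@expmax R I) (fun=> 0) <=
   iter n (sign_step q (fun c i => \sum_j lx i j * v c j)) (@expmax R I) (fun=> 0).
  apply: sym => [c i|c i i'].
    by rewrite linl !normrM ler_wpM2l.
  by rewrite !linl -!mulrBr !normrM ler_wpM2l.
have mgf := @iter_sign_step_le R I C q q_ge0 q_sum1 p lx v (l * B) V (l * K).
have {}mgf : iter n (sign_step q (fun c i => \sum_j lx i j * v c j))
    (@expmax R I) (fun=> 0) <= expR (8 * (l * K) ^+ 2) ^+ n * (2 * p%:R).
  have := mgf _ vV _ _ p0 n (fun=> 0).
  rewrite (_ : (fun i => \sum_j lx i j * 0) = (fun=> 0)); last first.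
    by apply/funext => i; rewrite big1// => j _; rewrite mulr0.
  rewrite (_ : \sum_j _ = 2 * p%:R); last first.
    rewrite (eq_bigr (fun=> 2)) ?sumr_const ?card_ord ?mulr_natr// => j _.
    by rewrite mulr0 oppr0 expR0; ring.
  apply => [i| |].
  - rewrite (eq_bigr (fun j => l * `|x i j|)) -?mulr_sumr ?ler_pM2l// => j _.
    by rewrite normrM gtr0_norm.
  - by rewrite mulr_ge0// ltW.
  - by rewrite -mulrA ler_pM2l.
apply: (@le_trans _ _
  (expR (8 * (l * K) ^+ 2) ^+ n * (2 * p%:R) * expR (- (l * (n%:R * t))))).
  by rewrite ler_wpM2r ?expR_ge0// (le_trans sym).
rewrite mulrAC -expRM_natl -expRD mulrC ler_wpM2l ?mulr_ge0// ler_expR.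
rewrite le_eqVlt; apply/orP; left; apply/eqP; rewrite /l.
by field; exact: lt0r_neq0.
Qed.

(** The upper tails of f and of - f, which satisfy the same hypotheses. *)
Lemma two_sided_tail (f : C -> I -> R) n (t : R) : 0 < t ->
  (forall c i, `|f c i| <= `|\sum_j x i j * v c j|) ->
  (forall c i i', `|f c i - f c i'| <=
     `|\sum_j x i j * v c j - \sum_j x i' j * v c j|) ->
  \sum_(a : n.-tuple C |
      [exists i, n%:R * t < `|\sum_(k < n) (f (tnth a k) i - \sum_c q c * f c i)|])
     weight a
  <= 4 * p%:R * expR (- (n%:R * t ^+ 2 / (32 * K ^+ 2))).
Proof.
move=> t0 fg fgB.
have w0 n' (a : n'.-tuple C) : 0 <= weight a by exact: prodr_ge0.
have up := upper_tail n t0 fg fgB.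
have lo : \sum_(a : n.-tuple C | [exists i, n%:R * t <
      \sum_(k < n) (- f (tnth a k) i - \sum_c q c * - f c i)]) weight a
    <= 2 * p%:R * expR (- (n%:R * t ^+ 2 / (32 * K ^+ 2))).
  apply: (@upper_tail (fun c i => - f c i)) => // [c i|c i i'].
    by rewrite normrN.
  by rewrite -opprD normrN.
rewrite (_ : 4 * p%:R * _ = 2 * p%:R * expR (- (n%:R * t ^+ 2 / (32 * K ^+ 2)))
  + 2 * p%:R * expR (- (n%:R * t ^+ 2 / (32 * K ^+ 2)))); last by ring.
apply: le_trans (lerD up lo).
rewrite 3!(big_mkcond (fun a => [exists i, _])) -big_split/=.
apply: ler_sum => a _; case: ifPn => [/existsP[i]|_]; last first.
  by rewrite addr_ge0//; case: ifP.
rewrite ltr_normr => /orP[h|h].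
  rewrite [X in _ <= X + _](_ : _ = weight a).
    by rewrite lerDl; case: ifP.
  by rewrite ifT//; apply/existsP; exists i.
rewrite [X in _ <= _ + X](_ : _ = weight a).
  by rewrite lerDr; case: ifP.
rewrite ifT//; apply/existsP; exists i; apply: (lt_le_trans h).
rewrite -sumrN le_eqVlt; apply/orP; left; apply/eqP; apply: eq_bigr => k _.
rewrite opprB addrC; congr (_ + _).
by rewrite -sumrN; apply: eq_bigr => c _; rewrite mulrN opprK.
Qed.

End finite_tail.

(** * Uniform deviations of i.i.d. random variables *)

Section finite_unions.
Context d (T : measurableType d) (R : realType) (mu : measure T R).

Lemma measurable_bigsetU (J : Type) (s : seq J) (Q : pred J) (F : J -> set T) :
  (forall j, Q j -> measurable (F j)) ->
  measurable (\big[setU/set0]_(j <- s | Q j) F j).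
Proof.
by move=> mF; apply: (big_ind (fun A : set T => measurable A)) => //;
  exact: measurableU.
Qed.

Lemma measure_bigsetU_le (J : Type) (s : seq J) (Q : pred J) (F : J -> set T) :
  (forall j, Q j -> measurable (F j)) ->
  (mu (\big[setU/set0]_(j <- s | Q j) F j) <= \sum_(j <- s | Q j) mu (F j))%E.
Proof.
move=> mF; elim: s => [|j s IH]; first by rewrite !big_nil measure0.
rewrite !big_cons; case: ifPn => // Qj.
apply: (le_trans (measureU2 mu _ _)) => //; first exact: mF.
  exact: measurable_bigsetU.
exact: leeD.
Qed.

Lemma bigsetU_bigcup_finType (J : finType) (F : J -> set T) :
  \big[setU/set0]_(j : J) F j = \bigcup_(j in [set: J]) F j.
Proof.
have -> : [set: J] = [set` predT] by apply/seteqP; split => x.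
by rewrite (bigcup_pred predT F).
Qed.

End finite_unions.

Lemma sum_fiber_indic (T : Type) (R : realType) (C : finType) (k : T -> C)
    (h : C -> R) (x : T) :
  \sum_c h c * \1_(k @^-1` [set c]) x = h (k x).
Proof.
rewrite (bigD1 (k x))//= indicE mem_set// mulr1 big1 ?addr0// => c ck.
by rewrite indicE memNset ?mulr0// => /= /esym/eqP; apply/negP.
Qed.

Section quantization.
Context d (E : measurableType d) (R : realType).

Lemma measurable_truncn_fiber (h : E -> R) (k : nat) :
  (forall w, 0 <= h w) -> measurable_fun setT h ->
  measurable [set w | Num.truncn (h w) = k].
Proof.
move=> h0 mh.
rewrite (_ : [set w | _] = setT `&` h @^-1` `[k%:R, k.+1%:R[%classic).
  by apply: mh => //; exact: measurable_itv.
apply/seteqP; split => w /=; rewrite in_itv/=.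
  by move=> /eqP; rewrite truncn_eq.
by move=> [_ hk]; apply/eqP; rewrite truncn_eq.
Qed.

(** The cell of w records in which interval of length eta each f i w falls;
    boundedness makes the number of cells finite. *)
Lemma finite_quantization (I : finType) (f : I -> E -> R) (K eta : R) :
  (forall i, measurable_fun setT (f i)) -> (forall i w, `|f i w| <= K) ->
  0 < eta ->
  exists (C : finType) (cell : E -> C),
    (forall c, measurable (cell @^-1` [set c])) /\
    (forall w w', cell w = cell w' -> forall i, `|f i w - f i w'| <= eta).
Proof.
move=> mf fK eta0.
pose h i w := (f i w + K) / eta.
have h0 i w : 0 <= h i w.
  apply: divr_ge0; last exact: ltW.
  by have := fK i w; rewrite ler_norml => /andP[+ _]; lra.
pose N := Num.truncn (2 * K / eta).
have hN i w : (Num.truncn (h i w) <= N)%N.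
  apply: le_truncn; rewrite ler_pM2r ?invr_gt0//.
  by have := fK i w; rewrite ler_norml => /andP[_]; lra.
pose cell w : {ffun I -> 'I_N.+1} := [ffun i => inord (Num.truncn (h i w))].
have cellE w i : nat_of_ord (cell w i) = Num.truncn (h i w).
  by rewrite ffunE inordK// ltnS.
exists {ffun I -> 'I_N.+1}, cell; split => [c|w w' ww' i].
  rewrite (_ : _ @^-1` _ =
      \bigcap_(i in [set: I]) [set w | Num.truncn (h i w) = c i]).
    apply: fin_bigcap_measurable => // i _; apply: measurable_truncn_fiber => //.
    by apply: measurable_funM => //; apply: measurable_funD.
  apply/seteqP; split => [w /= <- i _ /=|w /= wc]; first by rewrite cellE.
  by apply/ffunP => i; apply/val_inj; rewrite /= cellE; exact: wc.
have := truncn_itv (h0 i w); have := truncn_itv (h0 i w').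
have <- : Num.truncn (h i w) = Num.truncn (h i w') by rewrite -!cellE ww'.
move: (Num.truncn _) => k; rewrite -natr1 => /andP[a1 a2] /andP[b1 b2].
have -> : f i w - f i w' = eta * (h i w - h i w').
  by rewrite /h; field; exact: lt0r_neq0.
rewrite normrM gtr0_norm// ler_piMr ?(ltW eta0)// ler_norml; lra.
Qed.

End quantization.

Section uniform_deviation.
Context d (Om : measurableType d) (R : realType) (P : probability Om R).
Context d' (E : measurableType d').
Variables (n : nat) (W : {RV P >-> E}) (Ws : 'I_n -> {RV P >-> E}).
Hypothesis iid : iid_copies W Ws.

Lemma measurable_RV_preimage (X : {RV P >-> E}) (A : set E) :
  measurable A -> measurable (X @^-1` A).
Proof. by move=> mA; rewrite -[_ @^-1` _]setTI; apply: measurable_funP. Qed.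

Lemma bounded_RV_integrable (f : E -> R) (K : R) (X : {RV P >-> E}) :
  measurable_fun setT f -> (forall w, `|f w| <= K) ->
  P.-integrable setT (EFin \o (fun om => f (X om))).
Proof.
move=> mf fK; apply: measurable_bounded_integrable => //.
- by rewrite (le_lt_trans (probability_le1 _ _)) ?ltry.
- exact: measurableT_comp.
- exists K; split; first exact: num_real.
  by move=> x Kx om _ /=; rewrite (le_trans (fK _))// ltW.
Qed.

Section cells.
Variables (C : finType) (cell : E -> C).
Hypothesis mcell : forall c, measurable (cell @^-1` [set c]).

Definition cell_prob c : R := fine (P (W @^-1` (cell @^-1` [set c]))).

Lemma cell_probE c : P (W @^-1` (cell @^-1` [set c])) = (cell_prob c)%:E.
Proof. by rewrite /cell_prob fineK// fin_num_measure//; exact: measurable_RV_preimage. Qed.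

Lemma cell_prob_ge0 c : 0 <= cell_prob c.
Proof. exact: fine_ge0. Qed.

(** The law of the cell of W is the weight q of the finite-alphabet
    inequalities. *)
Lemma mean_cell (h : C -> R) :
  \int[P]_om h (cell (W om)) = \sum_c cell_prob c * h c.
Proof.
pose A c := W @^-1` (cell @^-1` [set c]).
have mA c : measurable (A c) by exact: measurable_RV_preimage.
rewrite /Rintegral -[RHS]/(fine (\sum_c cell_prob c * h c)%:E) -sumEFin.
congr fine.
transitivity (\int[P]_om (\sum_c (h c * \1_(A c) om)%:E))%E.
  apply: eq_integral => om _; rewrite sumEFin; congr EFin.
  exact: esym (sum_fiber_indic (cell \o W) h om).
rewrite integral_sum//.
  apply: eq_bigr => c _.
  under eq_integral do rewrite EFinM.
  rewrite integralZl//; last exact: integrable_indic.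
  rewrite integral_indic// setIT [X in (_ * X)%E]cell_probE.
  by rewrite -EFinM mulrC.
move=> c; under eq_fun do rewrite EFinM.
by apply: integrableZl => //; exact: integrable_indic.
Qed.

Lemma cell_prob_sum1 : \sum_c cell_prob c = 1.
Proof.
have := mean_cell (fun=> 1); rewrite Rintegral_cst//.
rewrite mul1r; under eq_bigr do rewrite mulr1.
by move=> <-; exact: (congr1 fine (probability_setT P)).
Qed.

(** Independence enters here: the vector of cells of the sample is a sequence of
    independent letters. *)
Lemma cylinder_prob (a : n.-tuple C) :
  P (\bigcap_(k in [set: 'I_n]) (Ws k @^-1` (cell @^-1` [set tnth a k])))
  = (\prod_(k < n) cell_prob (tnth a k))%:E.
Proof.
have [same indep] := iid.
rewrite (indep (fun k => cell @^-1` [set tnth a k]))// -prodEFin.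
by apply: eq_bigr => k _; rewrite -cell_probE; exact: same.
Qed.

Lemma cell_event_le (Q : pred (n.-tuple C)) (B : set Om) : measurable B ->
  (forall om, B om -> Q [tuple cell (Ws k om) | k < n]) ->
  (P B <= (\sum_(a | Q a) \prod_(k < n) cell_prob (tnth a k))%:E)%E.
Proof.
move=> mB BQ.
pose F (a : n.-tuple C) :=
  \bigcap_(k in [set: 'I_n]) (Ws k @^-1` (cell @^-1` [set tnth a k])).
have mF a : measurable (F a).
  by apply: fin_bigcap_measurable => // k _; exact: measurable_RV_preimage.
have BF : B `<=` \big[setU/set0]_(a | Q a) F a.
  move=> om /BQ Qom.
  rewrite -(bigcup_pred (fun a => Q a)).
  exists [tuple cell (Ws k om) | k < n] => // k _ /=.
  by rewrite tnth_mktuple.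
apply: (@le_trans _ _ (P (\big[setU/set0]_(a | Q a) F a))).
  by apply: le_measure => //; rewrite inE//; exact: measurable_bigsetU.
apply: (le_trans (measure_bigsetU_le _ _ _)) => //.
by rewrite -sumEFin; apply: lee_sum => a _; rewrite -cylinder_prob.
Qed.

End cells.

Section linear_majorant.
Variables (p : nat) (v : E -> 'I_p -> R) (B V K t : R).
Hypotheses (vV : forall w j, `|v w j| <= V) (B0 : 0 <= B) (BVK : B * V <= K)
  (K0 : 0 < K) (t0 : 0 < t) (n0 : (0 < n)%N)
  (p0 : (0 < p)%N).

(** The empirical average minus the expectation. *)
Definition deviation (f : E -> R) om : R :=
  n%:R^-1 * (\sum_(k < n) f (Ws k om)) - \int[P]_om' f (W om').

Lemma measurable_deviation f : measurable_fun setT f ->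
  measurable_fun setT (deviation f).
Proof.
move=> mf; apply: measurable_funB => //.
apply: measurable_funM => //.
by apply: measurable_sum => k; exact: measurableT_comp.
Qed.

Lemma measurable_deviation_gt f s : measurable_fun setT f ->
  measurable [set om | s < `|deviation f om|].
Proof.
move=> mf; rewrite -[X in measurable X]setTI.
have : measurable_fun setT (fun om => `|deviation f om|).
  by apply: measurableT_comp => //; exact: measurable_deviation.
move=> /(_ measurableT `]s, +oo[%classic (measurable_itv _)).
congr measurable; apply/seteqP.
by split => om /=; rewrite in_itv/= andbT.
Qed.

(** Replacing each observation by a representative of its cell moves the
    average and the mean by at most t / 2 each, so that a deviation above 2 t
    becomes a deviation above t over the finite alphabet. *)
Lemma finite_uniform_deviation (I : finType) (f : I -> E -> R)
    (x : I -> 'I_p -> R) :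
  (forall i, measurable_fun setT (f i)) ->
  (forall i, \sum_j `|x i j| <= B) ->
  (forall i w, `|f i w| <= `|\sum_j x i j * v w j|) ->
  (forall i i' w, `|f i w - f i' w| <=
     `|\sum_j x i j * v w j - \sum_j x i' j * v w j|) ->
  (P (\bigcup_(i in [set: I]) [set om | (2 * t < `|deviation (f i) om|)%R]) <=
   (4 * p%:R * expR (- (n%:R * t ^+ 2 / (32 * K ^+ 2))))%:E)%E.
Proof.
move=> mf xB fg fgB.
have fK i w : `|f i w| <= K.
  apply: (le_trans (fg i w)); apply: le_trans BVK.
  apply: (le_trans (ler_norm_sum _ _ _)).
  apply: (@le_trans _ _ (\sum_j `|x i j| * V)).
    by apply: ler_sum => j _; rewrite normrM ler_wpM2l.
  rewrite -mulr_suml ler_wpM2r//.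
  exact: le_trans (normr_ge0 _) (vV w (Ordinal p0)).
have [C [cell [mcell cellf]]] := finite_quantization mf fK (divr_gt0 t0 (ltr0Sn R 1)).
pose rep c : E := xget point (cell @^-1` [set c]).
have repE w : cell (rep (cell w)) = cell w.
  exact: (@xgetPex _ point (cell @^-1` [set cell w]) (ex_intro _ w erefl)).
have repf i w : `|f i (rep (cell w)) - f i w| <= t / 2 by exact: cellf.
have mrep i : `|\sum_c cell_prob cell c * f i (rep c) - \int[P]_om f i (W om)| <= t / 2.
  have intf := bounded_RV_integrable W (mf i) (fK i).
  have mfr : measurable_fun setT (fun w => f i (rep (cell w))).
    rewrite (_ : (fun w => _) = (fun w => \sum_c f i (rep c) * \1_(cell @^-1` [set c]) w)).
      apply: measurable_sum => c; apply: measurable_funM => //.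
    by apply/funext => w; rewrite (sum_fiber_indic cell (fun c => f i (rep c))).
  have intfr := bounded_RV_integrable W mfr (fun w => fK i _).
  rewrite -(mean_cell mcell (fun c => f i (rep c))) -RintegralB//.
  apply: (le_trans (le_normr_Rintegral _ _)) => //.
    exact: (@bounded_RV_integrable (fun w => f i (rep (cell w)) - f i w) (t / 2)
      W (measurable_funB mfr (mf i)) (repf i)).
  have -> : t / 2 = \int[P]_om (t / 2).
    by rewrite Rintegral_cst// (congr1 fine (probability_setT P)) mulr1.
  apply: le_Rintegral => //.
  - apply: (@bounded_RV_integrable (fun w => `|f i (rep (cell w)) - f i w|) (t / 2)).
      by apply: measurableT_comp => //; exact: measurable_funB.
    by move=> w; rewrite normr_id.
  - by apply: (@bounded_RV_integrable (fun=> t / 2) (t / 2)) => // w;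
      rewrite ger0_norm// divr_ge0// ltW.
pose Q (a : n.-tuple C) := [exists i, n%:R * t < `|\sum_(k < n)
  (f i (rep (tnth a k)) - \sum_c cell_prob cell c * f i (rep c))|].
apply: le_trans (_ : (_ <= (\sum_(a | Q a) \prod_(k < n) cell_prob cell (tnth a k))%:E)%E) _.
  apply: cell_event_le => //.
    by apply: fin_bigcup_measurable => // i _; exact: measurable_deviation_gt.
  move=> om [i _ /=]; rewrite /deviation => dev; apply/existsP; exists i.
  have nr0 : n%:R != 0 :> R by rewrite pnatr_eq0 -lt0n.
  pose m := \sum_c cell_prob cell c * f i (rep c).
  suff key : t < `|n%:R^-1 * (\sum_(k < n) f i (rep (cell (Ws k om)))) - m|.
    have sumE : \sum_(k < n) (f i (rep (tnth [tuple cell (Ws k0 om) | k0 < n] k)) - m)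
        = n%:R * (n%:R^-1 * (\sum_(k < n) f i (rep (cell (Ws k om)))) - m).
      under eq_bigr do rewrite tnth_mktuple.
      by rewrite sumrB sumr_const card_ord -[m *+ n]mulr_natl; field.
    suff : n%:R * t < `|\sum_(k < n)
      (f i (rep (tnth [tuple cell (Ws k0 om) | k0 < n] k)) - m)| by [].
    by rewrite sumE normrM ger0_norm// ltr_pM2l// ltr0n.
  have s1 : `|n%:R^-1 * (\sum_(k < n) f i (rep (cell (Ws k om))))
      - n%:R^-1 * (\sum_(k < n) f i (Ws k om))| <= t / 2.
    rewrite -mulrBr -sumrB normrM ger0_norm ?invr_ge0//.
    rewrite ler_pdivrMl ?ltr0n//; apply: (le_trans (ler_norm_sum _ _ _)).
    apply: (@le_trans _ _ (\sum_(k < n) t / 2)); first exact: ler_sum.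
    by rewrite sumr_const card_ord mulr_natl.
  have s2 := mrep i; rewrite -/m in s2.
  move: dev s1 s2.
  move: (n%:R^-1 * _) (n%:R^-1 * _) (\int[P]_om' _) m => a b c e.
  rewrite ltr_normr !ler_norml => /orP dev /andP[a1 a2] /andP[b1 b2].
  by rewrite ltr_normr; apply/orP; case: dev => dev; [left|right]; lra.
rewrite lee_fin.
exact: (@two_sided_tail R I C (cell_prob cell) (cell_prob_ge0 cell) (cell_prob_sum1 mcell) p x
  (fun c => v (rep c)) B V K xB (fun c => vV (rep c)) B0 BVK K0 p0 (fun c i => f i (rep c))).
Qed.

(** The union over a sequence is the increasing union of finite ones. *)
Lemma uniform_deviation (f : nat -> E -> R) (x : nat -> 'I_p -> R) :
  (forall i, measurable_fun setT (f i)) ->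
  (forall i, \sum_j `|x i j| <= B) ->
  (forall i w, `|f i w| <= `|\sum_j x i j * v w j|) ->
  (forall i i' w, `|f i w - f i' w| <=
     `|\sum_j x i j * v w j - \sum_j x i' j * v w j|) ->
  (P (\bigcup_i [set om | (2 * t < `|deviation (f i) om|)%R]) <=
   (4 * p%:R * expR (- (n%:R * t ^+ 2 / (32 * K ^+ 2))))%:E)%E.
Proof.
move=> mf xB fg fgB.
pose A i := [set om | 2 * t < `|deviation (f i) om|].
have mA i : measurable (A i) by exact: measurable_deviation_gt.
pose F N := \big[setU/set0]_(i < N) A i.
have mF N : measurable (F N) by exact: measurable_bigsetU.
have FA : \bigcup_N F N = \bigcup_i A i.
  apply/seteqP; split => om [N _].
    by rewrite /F -bigcup_mkord => -[i _ Ai]; exists i.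
  by move=> AN; exists N.+1 => //; rewrite /F -bigcup_mkord; exists N => /=.
have cv : (P \o F) N @[N --> \oo] --> P (\bigcup_N F N).
  apply: nondecreasing_cvg_mu => //; first exact: bigcupT_measurable.
  by move=> N M NM; apply/subsetPset; exact: subset_bigsetU.
rewrite -/A -FA -(cvg_lim _ cv)//.
apply: lime_le; first by apply/cvg_ex; eexists; exact: cv.
apply: nearW => N /=.
apply: le_trans (@finite_uniform_deviation 'I_N (fun i => f i) (fun i => x i) _ _ _ _) => //.
apply: le_measure; rewrite ?inE//.
  by apply: fin_bigcup_measurable => // i _; exact: mA.
by rewrite /F => om; rewrite -bigcup_mkord => -[i /= iN Ai]; exists (Ordinal iN).
Qed.

End linear_majorant.
End uniform_deviation.

(** * Supports and dense sequences of row vectors *)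

Section row_vectors.
Variables (R : realType) (n : nat).
Implicit Types (x y : 'rV[R]_n).

Lemma rV_norm_lt x (e : R) : 0 < e -> (forall j, `|x ord0 j| < e) -> `|x| < e.
Proof.
move=> e0 xe; rewrite [`|x|]mx_normrE.
apply/bigmax_ltP; split => // -[i j] _ /=; rewrite (ord1 i); exact: xe.
Qed.

Lemma rV_entry_le x j : `|x ord0 j| <= `|x|.
Proof.
rewrite [leRHS]mx_normrE.
exact: (le_bigmax _ (fun ij : 'I_1 * 'I_n => `|x ij.1 ij.2|) (ord0, j)).
Qed.

Lemma rV_rat_approx x (e : R) : 0 < e ->
  exists q : 'rV[rat]_n, `|x - map_mx ratr q| < e.
Proof.
move=> e0.
have h j : exists q : rat, `|x ord0 j - ratr q| < e.
  have lt_itv : x ord0 j - e < x ord0 j + e by rewrite ltrBlDr -addrA ltrDl addr_gt0.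
  have [q] := rat_in_itvoo lt_itv.
  rewrite in_itv/= => qx; exists q; move: qx; move: (ratr q) (x ord0 j) => a b.
  by rewrite ltr_norml => /andP[q1 q2]; lra.
have [q hq] := choice h.
exists (\row_j q j); apply: rV_norm_lt => // j; rewrite !mxE; exact: hq.
Qed.

(** A countable base of the topology, indexed through an encoding of a rational
    centre and a radius 1 / (m + 1). *)
Definition rational_ball (k : nat) : set 'rV[R]_n :=
  if @unpickle ('rV[rat]_n * nat)%type k is Some qm
  then ball (map_mx ratr qm.1 : 'rV[R]_n) (qm.2.+1%:R^-1) else set0.

Lemma rational_ball_open k : open (rational_ball k).
Proof.
rewrite /rational_ball; case: unpickle => [qm|]; last exact: open0.
by apply: ball_open; rewrite invr_gt0.
Qed.

(** A rational centre within 1 / (m + 1) of x gives a ball that contains x and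
    lies within 2 / (m + 1) of it. *)
Lemma rational_ball_basis x (B : set 'rV[R]_n) : nbhs x B ->
  exists2 k, rational_ball k x & rational_ball k `<=` B.
Proof.
move=> /nbhs_ballP[e /= e0 eB].
pose m := Num.truncn (2 / e).
have me : 2 * m.+1%:R^-1 < e.
  rewrite ltr_pdivrMr ?ltr0n// mulrC -ltr_pdivrMr//.
  exact: truncnS_gt.
have m0 : 0 < m.+1%:R^-1 :> R by rewrite invr_gt0.
have [q xq] := rV_rat_approx x m0.
have qx : ball (map_mx ratr q : 'rV[R]_n) m.+1%:R^-1 x.
  by rewrite -ball_normE/= distrC.
exists (pickle (q, m)); rewrite /rational_ball pickleK//= => y qy.
apply: eB; rewrite -ball_normE/=; move: qx qy; rewrite -ball_normE/=.
move=> qx qy; rewrite (_ : x - y = x - map_mx ratr q + (map_mx ratr q - y)).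
  apply: (le_lt_trans (ler_normD _ _)); apply: lt_trans me.
  by rewrite mulr_natl mulr2n; apply: ltrD.
by rewrite addrA subrK.
Qed.

Lemma dense_sequence (A : set 'rV[R]_n) : A !=set0 ->
  exists s : nat -> 'rV[R]_n, (forall k, A (s k)) /\
    forall x, A x -> forall e : R, 0 < e -> exists k, `|x - s k| < e.
Proof.
move=> [a0 Aa0].
pose s k := xget a0 (A `&` rational_ball k).
exists s; split => [k|x Ax e e0].
  by rewrite /s; case: xgetP => [y _ []|].
have [k kx kB] := rational_ball_basis (nbhsx_ballx x e e0).
exists k; have [_ /kB] : (A `&` rational_ball k) (s k).
  by apply: (@xgetPex _ a0); exists x.
by rewrite -ball_normE.
Qed.

Context d (Om : measurableType d) (P : probability Om R).

(** An open set that meets the support has positive probability. *)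
Lemma rv_support_closed (E : topologicalType) (X : Om -> E) :
  closed (rv_support P X).
Proof.
move=> x clx B oB Bx; have [y [sy By]] := clx B (open_nbhs_nbhs (conj oB Bx)).
exact: sy.
Qed.

Lemma rv_support_comp (E F : topologicalType) (X : Om -> E) (h : E -> F) :
  continuous h -> forall u, rv_support P X u -> rv_support P (h \o X) (h u).
Proof.
move=> ch u su B oB Bhx; rewrite comp_preimage; apply: su => //.
by apply: open_comp => // y _; exact: ch.
Qed.

Lemma borel_rV_open (B : set 'rV[R]_n) : open B ->
  measurable (B : set (borel_rV R n)).
Proof. by move=> oB; exact: sub_sigma_algebra. Qed.

Lemma borel_rV_closed (B : set 'rV[R]_n) : closed B ->
  measurable (B : set (borel_rV R n)).
Proof.
move=> cB; rewrite -[B]setCK; apply: measurableC; apply: borel_rV_open.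
exact: closed_openC.
Qed.

(** The complement of the support is a union of null basic balls, and there are
    only countably many of them. *)
Lemma rv_support_negligible (X : Om -> borel_rV R n) :
  measurable_fun setT X ->
  P (X @^-1` (~` rv_support P (X : Om -> 'rV[R]_n))) = 0%E.
Proof.
move=> mX.
have mXi (B : set (borel_rV R n)) : measurable B -> measurable (X @^-1` B).
  by move=> mB; rewrite -[_ @^-1` _]setTI; exact: mX.
have mS : measurable (X @^-1` (~` rv_support P (X : Om -> 'rV[R]_n))).
  apply: mXi; apply: measurableC; apply: borel_rV_closed.
  exact: rv_support_closed.
apply/eqP; rewrite eq_le measure_ge0 andbT.
pose F k := if P (X @^-1` rational_ball k) == 0%E then X @^-1` rational_ball k
  else set0.
have mF k : measurable (F k).
  rewrite /F; case: ifP => // _; apply: mXi.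
  by apply: borel_rV_open; exact: rational_ball_open.
have F0 k : P (F k) = 0%E by rewrite /F; case: ifPn => [/eqP//|_]; rewrite measure0.
have FN : P.-negligible (\bigcup_k F k).
  by apply: negligible_bigcup => k; apply/(negligibleP P (mF k)); exact: F0.
have <- := (negligibleP P (bigcupT_measurable _ mF)).1 FN.
apply: le_measure; rewrite ?inE//; first exact: bigcupT_measurable.
move=> om /= /existsNP[B] /not_implyP[oB] /not_implyP[BX] /negP.
rewrite -leNgt => PB.
have [k kX kB] := rational_ball_basis (open_nbhs_nbhs (conj oB BX)).
exists k => //; rewrite /F ifT//; rewrite eq_le measure_ge0 andbT.
apply: le_trans PB; apply: le_measure; rewrite ?inE.
- by apply: mXi; apply: borel_rV_open; exact: rational_ball_open.
- by apply: mXi; exact: borel_rV_open.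
- by move=> om'; exact: kB.
Qed.

End row_vectors.

(** * Borel maps and derivatives along lines *)

Section borel_maps.
Variable R : realType.

Lemma continuous_borel_rV n m (f : 'rV[R]_n -> 'rV[R]_m) : continuous f ->
  measurable_fun setT (f : borel_rV R n -> borel_rV R m).
Proof.
move=> cf; have := @measurability _ _ (borel_rV R n) (borel_rV R m) setT f (@open 'rV[R]_m).
apply => //.
move=> _ [B oB <-]; rewrite setTI; apply: borel_rV_open.
by apply: open_comp => // x _; exact: cf.
Qed.

Lemma continuous_borel_real n (f : 'rV[R]_n -> R) : continuous f ->
  measurable_fun setT (f : borel_rV R n -> R).
Proof.
move=> cf; apply: (measurability _ (RGenOpens.measurableE R)).
move=> _ [_ [a [b ->] <-]]; rewrite setTI; apply: borel_rV_open.
by apply: open_comp => [x _|]; [exact: cf|exact: interval_open].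
Qed.

Lemma near_dist_lt (V : normedModType R) (x : V) (e : R) : 0 < e ->
  \forall y \near x, `|x - y| < e.
Proof. by move=> e0; have := nbhsx_ballx x e e0; rewrite -ball_normE. Qed.

Lemma continuous_colsub n m (s : 'I_m -> 'I_n) :
  continuous (fun w : 'rV[R]_n => colsub s w).
Proof.
move=> w.
suff : forall e : R, 0 < e -> \forall w' \near w, `|colsub s w - colsub s w'| < e.
  by move/(@cvgrPdist_lt _ _ _ _ (nbhs_filter w)).
move=> e e0; apply: filterS (near_dist_lt w e0) => w' ww'.
apply: rV_norm_lt => // j; rewrite !mxE.
have := rV_entry_le (w - w') (s j); rewrite !mxE => /le_lt_trans; apply.
exact: ww'.
Qed.

Lemma dotvB n (u v w : 'rV[R]_n) : dotv u (v - w) = dotv u v - dotv u w.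
Proof. by rewrite /dotv -sumrB; apply: eq_bigr => j _; rewrite !mxE mulrBr. Qed.

Lemma dotvD n (u v w : 'rV[R]_n) : dotv u (v + w) = dotv u v + dotv u w.
Proof. by rewrite /dotv -big_split; apply: eq_bigr => j _; rewrite !mxE mulrDr. Qed.

Lemma dotvZ n (u v : 'rV[R]_n) a : dotv u (a *: v) = a * dotv u v.
Proof. by rewrite /dotv mulr_sumr; apply: eq_bigr => j _; rewrite !mxE mulrCA. Qed.

Lemma dotvC n (u v : 'rV[R]_n) : dotv u v = dotv v u.
Proof. by apply: eq_bigr => j _; rewrite mulrC. Qed.

Lemma dotv_delta n (u : 'rV[R]_n) j : dotv u (delta_mx ord0 j) = u ord0 j.
Proof.
rewrite /dotv (bigD1 j)//= !mxE !eqxx mulr1 big1 ?addr0// => i /negPf ij.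
by rewrite mxE ij andbF mulr0.
Qed.

Lemma l1norm_le_norm n (u : 'rV[R]_n) : l1norm u <= n%:R * `|u|.
Proof.
rewrite mulr_natl -[X in _ *+ X]card_ord -sumr_const.
by apply: ler_sum => j _; exact: rV_entry_le.
Qed.

Lemma dotv_le_l1norm n (u v : 'rV[R]_n) (U : R) : (forall j, `|u ord0 j| <= U) ->
  `|dotv u v| <= U * l1norm v.
Proof.
move=> uU; apply: (le_trans (ler_norm_sum _ _ _)); rewrite mulr_sumr.
by apply: ler_sum => j _; rewrite normrM ler_wpM2r.
Qed.

Lemma continuous_dotv n (v : 'rV[R]_n) : continuous (fun u => dotv u v).
Proof.
move=> u.
suff : forall e : R, 0 < e -> \forall u' \near u, `|dotv u v - dotv u' v| < e.
  by move/(@cvgrPdist_lt _ _ _ _ (nbhs_filter u)).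
move=> e e0.
have c0 : 0 < `|v| * n%:R + 1 by rewrite ltr_wpDl// mulr_ge0.
apply: filterS (near_dist_lt u (divr_gt0 e0 c0)) => u' uu'.
rewrite [dotv u v]dotvC [dotv u' v]dotvC -dotvB.
apply: (le_lt_trans (dotv_le_l1norm (U := `|v|) _ (rV_entry_le v))).
apply: (@le_lt_trans _ _ (`|v| * (n%:R * `|u - u'|))).
  by rewrite ler_wpM2l// l1norm_le_norm.
apply: (@le_lt_trans _ _ ((`|v| * n%:R + 1) * `|u - u'|)).
  by rewrite mulrA ler_wpM2r// lerDl.
by rewrite mulrC -ltr_pdivlMr.
Qed.

Lemma measurable_entry n j :
  measurable_fun setT ((fun u : 'rV[R]_n => u ord0 j) : borel_rV R n -> R).
Proof.
rewrite (_ : (fun u => _) = (fun u => dotv u (delta_mx ord0 j))).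
  by apply: continuous_borel_real; exact: continuous_dotv.
by apply/funext => u; rewrite dotv_delta.
Qed.

End borel_maps.

Section lines.
Variable R : realType.

(** Both sides are the limit of the same difference quotients; this reduces
    directional derivatives to derivatives of functions of a real variable. *)
Lemma line_derive (V : normedModType R) (f : V -> R) (x v : V) (h d : R) :
  is_derive h 1 (fun k : R => f (k *: v + x)) d <-> is_derive (h *: v + x) v f d.
Proof.
have E : (fun k : R => k^-1 *: (f ((k *: 1 + h) *: v + x) - f (h *: v + x)))
       = (fun k : R => k^-1 *: (f (k *: v + (h *: v + x)) - f (h *: v + x))).
  by apply/funext => k; rewrite [k%:A]mulr1 scalerDl addrA.
split=> -[dv <-]; split.
- by move: dv; rewrite /derivable E.
- by rewrite /derive -E.
- by move: dv; rewrite /derivable -E.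
- by rewrite /derive E.
Qed.

Lemma is_derive_dotv n (phi : R -> R) (u x v : 'rV[R]_n) (d : R) :
  is_derive (dotv u x) (1 : R) phi d ->
  is_derive x v (fun y => phi (dotv u y)) (d * dotv u v).
Proof.
move=> dphi; rewrite -[x]add0r -(scale0r v); apply/line_derive.
have -> : (fun k : R => phi (dotv u (k *: v + x)))
    = phi \o (fun k => k * dotv u v + dotv u x).
  by apply/funext => k /=; rewrite dotvD dotvZ.
apply: is_derive1_comp; first by rewrite mul0r add0r.
apply: is_derive_eq; rewrite addr0 !scaler0 add0r; exact: mulr1.
Qed.

Lemma lipschitz_segment (f df : R -> R) (a b U : R) :
  (forall c, Num.min a b <= c <= Num.max a b ->
    is_derive c (1 : R) f (df c) /\ `|df c| <= U) ->
  `|f b - f a| <= U * `|b - a|.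
Proof.
wlog ab : a b / a <= b.
  move=> h dfU; have [|/ltW ba] := leP a b; first by move=> /h; exact.
  rewrite distrC [`|b - a|]distrC; apply: h => // c.
  by rewrite minC maxC; exact: dfU.
rewrite (min_idPl ab) (max_idPr ab) => dfU.
have [||c cab fE] := @MVT_segment R f df a b ab.
- move=> c; rewrite in_itv/= => /andP[/ltW ac /ltW cb].
  by apply: (dfU c _).1; rewrite ac cb.
- apply: continuous_in_subspaceT => c; rewrite inE/= in_itv/= => cab.
  apply: differentiable_continuous; apply/derivable1_diffP.
  by case: (dfU c cab).1.
by rewrite fE normrM ler_wpM2r//; exact: (dfU c cab).2.
Qed.

(** Each point of K has a ball of radius r inside T; the radius r / 2 serves all
    points within r / 2 of it, and compactness makes the radius uniform. *)
Lemma compact_thickening (K T : set R) : compact K -> open T -> K `<=` T ->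
  exists2 e : R, 0 < e & forall x y, K x -> `|y - x| < e -> T y.
Proof.
move=> cK oT KT.
have near_cover : \forall e \near 0^'+,
    K `<=` (fun x => forall y, `|y - x| < e -> T y).
  apply: ((compact_near_coveringP K).1 cK R (0^'+)
    (fun e x => forall y, `|y - x| < e -> T y)) => x Kx.
  have /nbhs_ballP[r /= r0 rT] : nbhs x T by apply: open_nbhs_nbhs; split=> //; exact: KT.
  exists (ball x (r / 2), [set e | e < r / 2]) => /=.
    split; first by apply: nbhsx_ballx; rewrite divr_gt0.
    by apply: nbhs_right_lt; rewrite divr_gt0.
  move=> [x' e] /= [+ er] y yx'; rewrite -ball_normE/= => xx'.
  apply: rT; rewrite -ball_normE/= distrC.
  rewrite (_ : y - x = (y - x') + (x' - x)); last by rewrite addrA subrK.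
  by apply: (le_lt_trans (ler_normD _ _)); rewrite [`|x' - x|]distrC; lra.
have [e [eT e0]] := filter_ex (filterI near_cover (nbhs_right_gt (0 : R))).
by exists e => // x y /eT; exact.
Qed.

(** Differentiation under the integral sign for the restriction of F to the line
    through x directed by v. *)
Lemma derive_integral (n : nat) d (Om : measurableType d) (P : probability Om R)
    (B : set Om) (F G : 'rV[R]_n -> Om -> R) (x v : 'rV[R]_n) (rho c : R) :
  measurable B -> 0 < rho ->
  (forall y, `|y - x| < rho -> P.-integrable B (EFin \o F y)) ->
  (forall y om, `|y - x| < rho -> B om ->
     is_derive y v (F ^~ om) (G y om) /\ `|G y om| <= c) ->
  is_derive x v (fun y => \int[P]_(om in B) F y om) (\int[P]_(om in B) G x om).
Proof.
move=> mB rho0 intF dF.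
pose r := rho / (`|v| + 1).
have v1 : 0 < `|v| + 1 by rewrite ltr_wpDl.
have r0 : 0 < r by rewrite divr_gt0.
have near_x h : h \in `]- r, r[ -> `|h *: v + x - x| < rho.
  rewrite in_itv/= => hr; rewrite addrK normrZ.
  have hr' : `|h| < r by rewrite ltr_norml.
  apply: (@le_lt_trans _ _ (`|h| * (`|v| + 1))); first by rewrite ler_wpM2l// lerDl.
  by rewrite -ltr_pdivlMr.
pose f h om := F (h *: v + x) om.
have df h om : h \in `]- r, r[ -> B om ->
    is_derive h (1 : R) (f ^~ om) (G (h *: v + x) om).
  move=> hr Bom.
  exact: ((line_derive (F ^~ om) x v h _).2 (dF _ _ (near_x h hr) Bom).1).
have I0 : `]- r, r[%classic (0 : R) by rewrite /= in_itv/= oppr_lt0 r0.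
have intf h : `]- r, r[%classic h -> P.-integrable B (EFin \o f h).
  by move=> hr; apply: intF; exact: near_x.
have derf h om : `]- r, r[%classic h -> B om -> derivable (f ^~ om) h 1.
  by move=> hr Bom; case: (df h om hr Bom).
have c0 om : 0 <= (cst `|c| : Om -> R) om by [].
have intc : P.-integrable B (EFin \o (cst `|c| : Om -> R)).
  apply: (integrableS measurableT) => //.
  exact: finite_measure_integrable_cst.
have ubf h om : `]- r, r[%classic h -> B om -> `|partial1of2 f h om| <= (cst `|c|) om.
  move=> hr Bom; rewrite partial1of2E; have [_ ->] := df h om hr Bom.
  by apply: (le_trans (dF _ _ (near_x h hr) Bom).2); exact: ler_norm.
have x0 : 0 *: v + x = x by rewrite scale0r add0r.
rewrite -[in is_derive x]x0.
apply: (line_derive (fun y => \int[P]_(om in B) F y om) x v 0 _).1; split.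
  exact: (derivable_under_integral mB I0 intf derf c0 intc ubf).
rewrite -derive1E (differentiation_under_integral mB I0 intf derf c0 intc ubf).
apply: eq_Rintegral => om; rewrite inE => Bom; rewrite partial1of2E.
by have [_ ->] := df 0 om I0 Bom; rewrite scale0r add0r.
Qed.

End lines.

(** * The design on its support *)

Section design.
Variables (R : realType) (n : nat) (S : setting R n) (U : R).
Hypotheses (Ssetting : single_index_setting S) (Sdomain : index_domain S)
  (Sregular : regular_setting S) (Ssmooth : smooth_bounded_design S U).

Local Notation p := (dimp S).
Local Notation rW := 'rV[R]_(dimW S).

Definition nuisance (w : rW) : 'rV[R]_(dimg S) := g0 S (subvec w).

Definition index_vector (w : rW) : 'rV[R]_p := Lam S (subvec w) (nuisance w).

Definition mom_dt (w : rW) (t : R) : R := derive1 (fun s => mom S w s (nuisance w)) t.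

(** The contribution of one observation to entry (a, b) of the Hessian of the
    loss at th. *)
Definition hessian_entry (th : 'rV[R]_p) (a b : 'I_p) (w : rW) : R :=
  mom_dt w (dotv (index_vector w) th)
  * index_vector w ord0 a * index_vector w ord0 b.

(** A set of full probability that does not depend on th, on which all the
    bounds of the design hold.  Membership of the whole vector of indices in its
    support controls the index at every th simultaneously. *)
Definition design_support : set rW :=
  [set w | [/\ rv_support (Pr S) (fun om => W S om : rW) w,
    rv_support (Pr S) (fun om => nuisance (W S om)) (nuisance w)
    & rv_support (Pr S) (fun om => index_vector (W S om)) (index_vector w)]].

Lemma continuous_subvec : continuous (@subvec R n S).
Proof. exact: continuous_colsub. Qed.

Lemma measurable_subvec :
  measurable_fun setT (@subvec R n S : borel_rV R (dimW S) -> borel_rV R (dimZ S)).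
Proof. by apply: continuous_borel_rV; exact: continuous_subvec. Qed.

Lemma measurable_nuisance :
  measurable_fun setT (nuisance : borel_rV R (dimW S) -> borel_rV R (dimg S)).
Proof.
case: Ssetting => -[_ _ Gg0 _] _ _ _; case: Sregular => _ _ _ mg _.
by apply: (measurableT_comp (mg _ Gg0)); exact: measurable_subvec.
Qed.

Lemma measurable_index_vector :
  measurable_fun setT (index_vector : borel_rV R (dimW S) -> borel_rV R p).
Proof.
case: Sregular => _ _ mL _ _.
have mpair : measurable_fun setT (fun w : borel_rV R (dimW S) =>
    (subvec w : borel_rV R (dimZ S), nuisance w : borel_rV R (dimg S))).
  apply/measurable_fun_pairP; split; first exact: measurable_subvec.
  exact: measurable_nuisance.
exact: (measurableT_comp mL mpair).
Qed.

Lemma measurable_index (th : 'rV[R]_p) : measurable_fun setT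
  ((fun w => dotv (index_vector w) th) : borel_rV R (dimW S) -> R).
Proof.
have mdot : measurable_fun setT ((fun u => dotv u th) : borel_rV R p -> R).
  by apply: continuous_borel_real; exact: continuous_dotv.
exact: (measurableT_comp mdot measurable_index_vector).
Qed.

Lemma measurable_index_entry j : measurable_fun setT
  ((fun w => index_vector w ord0 j) : borel_rV R (dimW S) -> R).
Proof. exact: (measurableT_comp (measurable_entry j) measurable_index_vector). Qed.

Lemma measurable_primitive (k : rW -> R -> 'rV[R]_(dimg S) -> R) (t : rW -> R) :
  measurable_fun setT
    (fun x : borel_rV R (dimW S) * R * borel_rV R (dimg S) => k x.1.1 x.1.2 x.2) ->
  measurable_fun setT (t : borel_rV R (dimW S) -> R) ->
  measurable_fun setT
    ((fun w => k w (t w) (nuisance w)) : borel_rV R (dimW S) -> R).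
Proof.
move=> mk mt.
have mtriple : measurable_fun setT (fun w : borel_rV R (dimW S) =>
    ((w, t w), nuisance w : borel_rV R (dimg S))).
  apply/measurable_fun_pairP; split; last exact: measurable_nuisance.
  by apply/measurable_fun_pairP; split => //; exact: measurable_id.
exact: (measurableT_comp mk mtriple).
Qed.

Lemma measurable_design_support :
  measurable (design_support : set (borel_rV R (dimW S))).
Proof.
pose A1 : set rW := rv_support (Pr S) (fun om => W S om : rW).
pose A2 := rv_support (Pr S) (fun om => nuisance (W S om)).
pose A3 := rv_support (Pr S) (fun om => index_vector (W S om)).
rewrite (_ : design_support = A1 `&` (nuisance @^-1` A2 `&` index_vector @^-1` A3)).
  apply: measurableI.
    by apply: borel_rV_closed; exact: rv_support_closed.
  apply: measurableI.
    rewrite -[_ @^-1` _]setTI; apply: measurable_nuisance => //.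
    by apply: borel_rV_closed; exact: rv_support_closed.
  rewrite -[_ @^-1` _]setTI; apply: measurable_index_vector => //.
  by apply: borel_rV_closed; exact: rv_support_closed.
by apply/seteqP; split => w /=; [case=> ? ? ?; split|case=> ? []].
Qed.

Lemma design_support_full : Pr S (W S @^-1` (~` design_support)) = 0%E.
Proof.
have mW : measurable_fun setT (W S) by exact: measurable_funP.
have n1 := rv_support_negligible (Pr S) mW.
have mN : measurable_fun setT
    ((fun om => nuisance (W S om)) : Om S -> borel_rV R (dimg S)).
  exact: (measurableT_comp measurable_nuisance mW).
have n2 := rv_support_negligible (Pr S) mN.
have mI : measurable_fun setT
    ((fun om => index_vector (W S om)) : Om S -> borel_rV R p).
  exact: (measurableT_comp measurable_index_vector mW).
have n3 := rv_support_negligible (Pr S) mI.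
apply/eqP; rewrite eq_le measure_ge0 andbT.
have mpre m (X : Om S -> borel_rV R m) : measurable_fun setT X ->
    measurable (X @^-1` (~` rv_support (Pr S) (X : Om S -> 'rV[R]_m))).
  move=> mX; rewrite -[_ @^-1` _]setTI; apply: mX => //; apply: measurableC.
  by apply: borel_rV_closed; exact: rv_support_closed.
have m1 := mpre _ _ mW; have m2 := mpre _ _ mN; have m3 := mpre _ _ mI.
pose N1 := W S @^-1` (~` rv_support (Pr S) (fun om => W S om : rW)).
pose N2 := (fun om => nuisance (W S om)) @^-1`
  (~` rv_support (Pr S) (fun om => nuisance (W S om))).
pose N3 := (fun om => index_vector (W S om)) @^-1`
  (~` rv_support (Pr S) (fun om => index_vector (W S om))).
apply: (@le_trans _ _ (Pr S (N1 `|` (N2 `|` N3)))).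
  apply: le_measure; rewrite ?inE.
  - by apply: measurable_RV_preimage; apply: measurableC; exact: measurable_design_support.
  - by apply: measurableU; [exact: m1|apply: measurableU; [exact: m2|exact: m3]].
  move=> om /= ns; apply/not_notP => /not_orP[/contrapT s1 /not_orP[/contrapT s2 /contrapT s3]].
  by apply: ns; split.
apply: (le_trans (measureU2 (Pr S) m1 (measurableU _ _ m2 m3))).
apply: (le_trans (leeD2l _ (measureU2 (Pr S) m2 m3))).
by rewrite [X in (X + _)%E]n1 [X in (_ + (X + _))%E]n2 [X in (_ + (_ + X))%E]n3 !adde0.
Qed.

Section on_support.
Variable w : rW.
Hypothesis sw : design_support w.

Lemma support_calW : calW S w.
Proof.
by case: Ssetting => _ _ _ [[_ _ sub] _ _]; case: sw => sw1 _ _; exact: sub.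
Qed.

(** The support of a continuous image contains the image of the support. *)
Lemma support_calZ : calZ (subvec w).
Proof.
case: sw => sw1 _ _.
exact: (rv_support_comp continuous_subvec sw1).
Qed.

Lemma support_Gam : Gam S (nuisance w).
Proof.
case: Ssetting => -[_ _ Gg0 _] _ _ [_ [_ _ sub] _].
by case: sw => _ sw2 _; exact: (sub _ Gg0).
Qed.

Lemma index_vector_le j : `|index_vector w ord0 j| <= U.
Proof.
case: Ssmooth => _ _ sI.
by have [] := sI _ _ support_calZ support_Gam j.
Qed.

Lemma support_segment th r : BTheta th -> 0 <= r <= 1 ->
  calT S (dotv (index_vector w) (theta0 S + r *: (th - theta0 S))).
Proof.
move=> Bth r01; apply: (Sdomain Bth r01).
case: sw => _ _ sw3.
exact: (rv_support_comp (@continuous_dotv _ _ (theta0 S + r *: (th - theta0 S))) sw3).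
Qed.

Lemma support_index_calT th : BTheta th -> calT S (dotv (index_vector w) th).
Proof.
move=> Bth; have := support_segment Bth (r := 1).
by rewrite scale1r addrC subrK; apply; rewrite ler01 lexx.
Qed.

Lemma support_index th : BTheta th ->
  rv_support (Pr S) (fun om => dotv (index_vector (W S om)) th)
    (dotv (index_vector w) th).
Proof.
case: sw => _ _ sw3 _.
exact: (rv_support_comp (@continuous_dotv _ _ th) sw3).
Qed.

Lemma smooth_at t : calT S t -> smooth_bounded_moment U w t (nuisance w).
Proof.
move=> Tt; case: Ssmooth => _ sm _.
exact: (sm _ _ _ support_calW Tt support_Gam).
Qed.

Lemma loss_derive t :
  is_derive t (1 : R) (fun s => loss S w s (nuisance w)) (mom S w t (nuisance w)).
Proof. by case: Ssetting => _ _ L _; apply: L; exact: support_calW. Qed.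

Lemma mom_le t : calT S t -> `|mom S w t (nuisance w)| <= U.
Proof. by move=> /smooth_at[]. Qed.

Lemma mom_derive t : calT S t ->
  is_derive t (1 : R) (fun s => mom S w s (nuisance w)) (mom_dt w t).
Proof.
by move=> /smooth_at[_ _ [dm _] _ _]; rewrite /mom_dt derive1E; exact: derivableP.
Qed.

Lemma mom_dt_le t : calT S t -> `|mom_dt w t| <= U.
Proof. by move=> /smooth_at[_ _ [_ dm] _ _]. Qed.

Lemma mom_dt_derive t : calT S t ->
  is_derive t (1 : R) (mom_dt w) (derive1 (mom_dt w) t) /\
  `|derive1 (mom_dt w) t| <= U.
Proof.
move=> /smooth_at[_ _ _ _ [_ [dm Um]]]; split => //.
by rewrite derive1E; exact: derivableP.
Qed.

(** The design controls the segments from the index at theta0 to the indices at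
    th and at th'.  On the real line two segments with a common end cover the
    segment between their other ends, so the mean value theorem applies between
    the indices at th and th' even where the segment from th to th' leaves B. *)
Lemma mom_dt_lipschitz th th' : BTheta th -> BTheta th' ->
  `|mom_dt w (dotv (index_vector w) th) - mom_dt w (dotv (index_vector w) th')|
  <= U * `|dotv (index_vector w) (th - th')|.
Proof.
move=> Bth Bth'; rewrite dotvB.
pose t0 := dotv (index_vector w) (theta0 S).
have star th1 c : BTheta th1 ->
    Num.min t0 (dotv (index_vector w) th1) <= c <=
    Num.max t0 (dotv (index_vector w) th1) -> calT S c.
  set t1 := dotv _ th1 => Bth1 c01.
  have [t01|t01] := eqVneq t0 t1.
    move: c01; rewrite t01 minxx maxxx => /le_anti <-.
    exact: support_index_calT.
  pose r := (c - t0) / (t1 - t0).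
  have t10 : t1 - t0 != 0 by rewrite subr_eq0 eq_sym.
  have cE : c = dotv (index_vector w) (theta0 S + r *: (th1 - theta0 S)).
    by rewrite dotvD dotvZ dotvB -/t1 -/t0 /r divfK// addrC subrK.
  rewrite cE; apply: support_segment => //.
  move: c01; have [t0t1|t1t0|E] := ltgtP t0 t1.
  - move=> /andP[c1 c2].
    apply/andP; split; first by apply: divr_ge0; rewrite subr_ge0// ltW.
    by rewrite ler_pdivrMr ?subr_gt0// mul1r lerD2r.
  - move=> /andP[c1 c2].
    have -> : r = (t0 - c) / (t0 - t1) by rewrite /r -mulrNN -invrN !opprB.
    apply/andP; split; first by apply: divr_ge0; rewrite subr_ge0// ltW.
    by rewrite ler_pdivrMr ?subr_gt0// mul1r lerD2l lerN2.
  - by rewrite E eqxx in t01.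
(* A point between the indices at th and th' lies, like both of them, on one
   of the two segments issued from t0. *)
rewrite distrC -[X in _ <= _ * X]distrC.
apply: (lipschitz_segment (df := derive1 (mom_dt w))) => c cseg.
apply: mom_dt_derive.
have := @star th c Bth; have := @star th' c Bth'.
rewrite -/t0; move: cseg.
set t := dotv _ th; set t' := dotv _ th'.
rewrite !ge_min !le_max => /andP[/orP c1 /orP c2] s' s.
have [ct0|ct0] := leP c t0.
  case: c1 => c1; [apply: s|apply: s']; rewrite ?ge_min ?le_max c1 ct0 ?orbT//.
by case: c2 => c2; [apply: s|apply: s']; rewrite ?ge_min ?le_max c2 (ltW ct0) ?orbT.
Qed.

Lemma hessian_entry_le th a b : BTheta th -> `|hessian_entry th a b w| <= U ^+ 3.
Proof.
move=> Bth; rewrite /hessian_entry !normrM.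
have Tth := support_index_calT Bth.
rewrite 2!exprS expr1 mulrA.
by apply: ler_pM; rewrite ?mulr_ge0//; [apply: ler_pM => //|];
  rewrite ?mom_dt_le ?index_vector_le.
Qed.

Lemma hessian_entry_lipschitz th th' a b : BTheta th -> BTheta th' ->
  `|hessian_entry th a b w - hessian_entry th' a b w| <=
  U ^+ 3 * `|dotv (index_vector w) (th - th')|.
Proof.
move=> Bth Bth'; rewrite /hessian_entry -!mulrBl !normrM.
have U0 : 0 <= U by apply: le_trans (index_vector_le a).
have lip := mom_dt_lipschitz Bth Bth'.
rewrite [leRHS](_ : _ = U * `|dotv (index_vector w) (th - th')| * U * U); last by ring.
by apply: ler_pM; rewrite ?mulr_ge0//; [apply: ler_pM => //|];
  exact: index_vector_le.
Qed.

Lemma loss_at_derive (th : 'rV[R]_p) b :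
  is_derive th (delta_mx ord0 b) (fun th' => loss_at th' (g0 S) w)
    (mom S w (dotv (index_vector w) th) (nuisance w) * index_vector w ord0 b).
Proof.
rewrite -dotv_delta; apply: (is_derive_dotv (phi := fun s => loss S w s (nuisance w))).
exact: loss_derive.
Qed.

Lemma loss_at_derive2 (th : 'rV[R]_p) a b :
  calT S (dotv (index_vector w) th) ->
  is_derive th (delta_mx ord0 a)
    (fun th' => mom S w (dotv (index_vector w) th') (nuisance w)
                * index_vector w ord0 b)
    (hessian_entry th a b w).
Proof.
move=> Tth.
have := is_derive_dotv (delta_mx ord0 a) (mom_derive Tth).
rewrite dotv_delta => dm.
have := is_deriveZ (index_vector w ord0 b) dm.
rewrite (_ : _ \*: _ = (fun th' => mom S w (dotv (index_vector w) th') (nuisance w)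
                * index_vector w ord0 b)); last first.
  by apply/funext => th' /=; rewrite mulrC.
by rewrite (_ : _ *: _ = hessian_entry th a b w)// /hessian_entry [RHS]mulrC.
Qed.

End on_support.

End design.

(** * The two Hessians as averages of the same function *)

Section hessians.
Variables (R : realType) (n : nat) (S : setting R n) (U : R).
Hypotheses (Ssetting : single_index_setting S) (Sdomain : index_domain S)
  (Sregular : regular_setting S) (Ssmooth : smooth_bounded_design S U).

Local Notation p := (dimp S).
Local Notation rW := 'rV[R]_(dimW S).
Local Notation D := (@design_support R n S).
Local Notation DB := (D : set (borel_rV R (dimW S))).

Lemma hessian_Qhat th om a b : (forall i, D (Ws S i om)) -> BTheta th ->
  hessian (fun th' => Qhat om th' (g0 S)) th a b
  = n%:R^-1 * \sum_(i < n) hessian_entry th a b (Ws S i om).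
Proof.
move=> Dom Bth; rewrite mxE.
have d1 th' : is_derive th' (delta_mx ord0 b) (fun th' => Qhat om th' (g0 S))
    (n%:R^-1 * \sum_(i < n) (mom S (Ws S i om)
       (dotv (index_vector (Ws S i om)) th') (nuisance (Ws S i om))
       * index_vector (Ws S i om) ord0 b)).
  have := is_deriveZ (n%:R^-1) (is_derive_sum (fun i =>
    loss_at_derive Ssetting (Dom i) th' b)).
  by congr is_derive; apply/funext => y /=; rewrite fct_sumE.
have -> : 'D_(delta_mx ord0 b) (fun th' => Qhat om th' (g0 S)) =
    (fun th' => n%:R^-1 * \sum_(i < n) (mom S (Ws S i om)
       (dotv (index_vector (Ws S i om)) th') (nuisance (Ws S i om))
       * index_vector (Ws S i om) ord0 b)).
  by apply/funext => th'; have [_ ->] := d1 th'.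
have Tth i := support_index_calT Sdomain (Dom i) Bth.
have d2 := is_deriveZ (n%:R^-1) (is_derive_sum (fun i =>
    loss_at_derive2 Ssetting Ssmooth (Dom i) a b (Tth i))).
case: d2 => _ d2; etransitivity; last exact: d2.
by congr ('D_ _ _ _); apply/funext => y /=; rewrite fct_sumE.
Qed.

(** The indices at th range over a compact subset of the open set calT S, so
    calT S contains a neighbourhood of them whose width does not depend on w. *)
Lemma index_thickening th : BTheta th ->
  exists2 e : R, 0 < e &
    forall w s, D w -> `|s - dotv (index_vector w) th| < e -> calT S s.
Proof.
move=> Bth.
pose K := rv_support (Pr S) (fun om => dotv (index_vector (W S om)) th)
  `&` `[- (U * l1norm th), U * l1norm th]%classic.
have cK : compact K.
  apply: (subclosed_compact _ (@segment_compact _ (- (U * l1norm th)) (U * l1norm th))).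
    by apply: closedI; [exact: rv_support_closed|exact: interval_closed].
  by move=> s [].
have oT : open (calT S) by case: Ssetting => _ _ _ [_ _ []].
have KT : K `<=` calT S.
  move=> s [sK _]; apply: (Sdomain Bth (r := 1)); first by rewrite ler01 lexx.
  by rewrite scale1r addrC subrK.
have [e e0 He] := compact_thickening cK oT KT.
exists e => // w s Dw; apply: He; split; first exact: support_index.
rewrite /= in_itv/= -ler_norml; apply: dotv_le_l1norm => j.
exact: (index_vector_le Ssetting Ssmooth Dw).
Qed.

(** On the support, d_t m is a pointwise limit of difference quotients of the
    measurable function m. *)
Lemma measurable_hessian_entry th a b : BTheta th ->
  measurable_fun setT (hessian_entry th a b \_ D : borel_rV R (dimW S) -> R).
Proof.
move=> Bth.
have mD := @measurable_design_support R n S Ssetting Sregular.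
apply/(measurable_restrictT _ mD).
pose t w := dotv (index_vector w) th.
have mt : measurable_fun DB (t : borel_rV R (dimW S) -> R).
  by apply: measurable_funTS; exact: measurable_index.
have me j : measurable_fun DB
    ((fun w => index_vector w ord0 j) : borel_rV R (dimW S) -> R).
  by apply: measurable_funTS; exact: measurable_index_entry.
apply: measurable_funM => //; apply: measurable_funM => //.
pose u (k : nat) : R := k.+1%:R^-1.
case: (Sregular) => mm _ _ _ _.
apply: (@measurable_fun_cvg _ _ _ DB (fun k w =>
  (u k)^-1 * (mom S w (u k + t w) (nuisance w) - mom S w (t w) (nuisance w)))).
  move=> k; apply: measurable_funM => //; apply: measurable_funTS.
  apply: measurable_funB.
    apply: (measurable_primitive Ssetting Sregular mm (t := fun w => u k + t w)).
    apply: measurable_funD => //; exact: measurable_index.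
  apply: (measurable_primitive Ssetting Sregular mm (t := t)).
  exact: measurable_index.
move=> w Dw.
have Tt : calT S (t w) := support_index_calT Sdomain Dw Bth.
have [dm dE] := mom_derive Ssetting Ssmooth Dw Tt.
rewrite -/(t w) -dE.
have u0 : (forall k, u k != 0) /\ (u k @[k --> \oo] --> (0 : R)).
  by split; [move=> k; rewrite invr_eq0 pnatr_eq0|exact: cvg_harmonic].
have := (cvgr_dnbhsP _ 0 _).1 dm u u0; apply: cvg_trans; apply: near_eq_cvg.
by apply: nearW => k /=; rewrite [(u k)%:A]mulr1.
Qed.

Definition good_event : set (Om S) := W S @^-1` D.

Lemma measurable_good_event : measurable good_event.
Proof. by apply: measurable_RV_preimage; exact: measurable_design_support. Qed.

Lemma integral_good_event (f : Om S -> R) : measurable_fun setT f ->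
  \int[Pr S]_om f om = \int[Pr S]_(om in good_event) f om.
Proof.
move=> mf; rewrite [RHS]Rintegral_mkcond /Rintegral; congr fine.
apply: ae_eq_integral => //; first exact/measurable_EFinP.
  apply/measurable_EFinP; apply/(measurable_restrictT _ measurable_good_event).
  exact: measurable_funTS.
exists (W S @^-1` (~` D)); split.
- by apply: measurable_RV_preimage; apply: measurableC; exact: measurable_design_support.
- exact: design_support_full.
- move=> om /= h Dom; apply: h => _; rewrite patchE mem_set//.
Qed.

Lemma mom_RV_integrable th b :
  (forall w, D w -> calT S (dotv (index_vector w) th)) ->
  (Pr S).-integrable good_event (EFin \o (fun om =>
    mom S (W S om) (dotv (index_vector (W S om)) th) (nuisance (W S om))
    * index_vector (W S om) ord0 b)).
Proof.
move=> Tth; case: (Sregular) => mm _ _ _ _.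
apply: measurable_bounded_integrable; first exact: measurable_good_event.
- by rewrite (le_lt_trans (probability_le1 _ _)) ?ltry//; exact: measurable_good_event.
- apply: measurable_funTS.
  have mW : measurable_fun setT (W S) by exact: measurable_funP.
  apply: measurable_funM.
    exact: (measurableT_comp (measurable_primitive Ssetting Sregular mm
      (measurable_index Ssetting Sregular th)) mW).
  exact: (measurableT_comp (measurable_index_entry Ssetting Sregular b) mW).
- exists (U * U); split; first exact: num_real.
  move=> x Ux om Dom /=; apply: (le_trans _ (ltW Ux)); rewrite normrM.
  apply: ler_pM => //; first exact: (mom_le Ssetting Ssmooth Dom (Tth _ Dom)).
  exact: (index_vector_le Ssetting Ssmooth Dom).
Qed.

Lemma measurable_loss_at th :
  measurable_fun setT (fun om => loss_at th (g0 S) (W S om)).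
Proof.
case: (Sregular) => _ ml _ _ _.
have mW : measurable_fun setT (W S) by exact: measurable_funP.
exact: (measurableT_comp (measurable_primitive Ssetting Sregular ml
      (measurable_index Ssetting Sregular th)) mW).
Qed.

(** Integrability of the loss is known at the points of B; the bound U on
    m = d_t loss extends it to the points whose index is close, which the second
    derivatives need since th + s e_b may leave B. *)
Lemma loss_RV_integrable th th' e : BTheta th ->
  (forall w s, D w -> `|s - dotv (index_vector w) th| < e -> calT S s) ->
  (forall w, D w ->
     `|dotv (index_vector w) th' - dotv (index_vector w) th| < e) ->
  (Pr S).-integrable good_event (EFin \o (fun om => loss_at th' (g0 S) (W S om))).
Proof.
move=> Bth He th'e; case: (Sregular) => _ _ _ _ intl.
have mB := measurable_good_event.
apply: (@le_integrable _ _ _ (Pr S) good_event mB _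
  (EFin \o (fun om => `|loss_at th (g0 S) (W S om)| + U * e))).
- by apply/measurable_EFinP; apply: measurable_funTS; exact: measurable_loss_at.
- move=> om Dom /=; rewrite lee_fin.
  set t := dotv (index_vector (W S om)) th.
  set t' := dotv (index_vector (W S om)) th'.
  have tt' : `|t' - t| < e by exact: th'e.
  have lip : `|loss_at th' (g0 S) (W S om) - loss_at th (g0 S) (W S om)|
      <= U * `|t' - t|.
    apply: (lipschitz_segment (f := fun s => loss S (W S om) s (nuisance (W S om)))
      (df := fun s => mom S (W S om) s (nuisance (W S om))) (a := t) (b := t'))
      => c c01; split.
      exact: loss_derive.
    apply: mom_le => //; apply: (He _ _ Dom).
    move: c01 tt'; rewrite -/t ge_min le_max !ltr_norml.
    by move: t t' c => t t' c; move=> /andP[/orP[] c1 /orP[] c2] /andP[c3 c4]; apply/andP; split; lra.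
  have U0 : 0 <= U.
    by apply: le_trans (mom_le Ssetting Ssmooth Dom (t := t) _) => //;
      apply: (He _ _ Dom); rewrite subrr normr0 (le_lt_trans _ tt').
  rewrite [leRHS]ger0_norm; last first.
    by rewrite addr_ge0// mulr_ge0//; exact: ltW (le_lt_trans _ tt').
  rewrite -[X in `|X| <= _](subrK (loss_at th (g0 S) (W S om))) addrC.
  apply: (le_trans (ler_normD _ _)); rewrite lerD2l.
  by apply: (le_trans lip); rewrite ler_wpM2l// ltW.
- apply: (integrableS measurableT) => //.
  rewrite (_ : EFin \o _ = (EFin \o (Num.norm \o (fun om => loss_at th (g0 S) (W S om))))
      \+ (EFin \o cst (U * e)))//.
  apply: integrableD => //; last exact: finite_measure_integrable_cst.
  exact: integrable_norm (intl _ Bth).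
Qed.

(** Differentiation under the integral sign, twice: the loss has derivative
    m L_b, bounded by U^2 in a ball around th of radius rho, and m L_b has
    derivative [hessian_entry], bounded by U^3 there. *)
Lemma hessian_Qpop th a b : BTheta th ->
  hessian (fun th' => Qpop th' (g0 S)) th a b
  = \int[Pr S]_om (hessian_entry th a b \_ D) (W S om).
Proof.
move=> Bth; rewrite mxE.
have [e e0 He] := index_thickening Bth.
have U0 : 0 <= U.
  case: (Ssmooth) => U1 _ _; case: Bth => _ /U1; apply: le_trans.
  by apply: sumr_ge0.
have Up0 : 0 < U * p%:R + 1 by rewrite ltr_wpDl// mulr_ge0.
pose rho := e / (U * p%:R + 1).
have rho0 : 0 < rho by rewrite divr_gt0.
have close th' : `|th' - th| < rho -> forall w, D w ->
    `|dotv (index_vector w) th' - dotv (index_vector w) th| < e.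
  move=> thrho w Dw; rewrite -dotvB.
  have lamU := index_vector_le Ssetting Ssmooth Dw.
  apply: (le_lt_trans (dotv_le_l1norm _ lamU)).
  apply: (@le_lt_trans _ _ (U * (p%:R * `|th' - th|))).
    by rewrite ler_wpM2l// l1norm_le_norm.
  apply: (@le_lt_trans _ _ ((U * p%:R + 1) * `|th' - th|)).
    by rewrite mulrA ler_wpM2r// lerDl.
  by rewrite mulrC -ltr_pdivlMr.
have Tclose th' : `|th' - th| < rho -> forall w, D w ->
    calT S (dotv (index_vector w) th').
  by move=> thrho w Dw; apply: (He w _ Dw); exact: close.
have mB := measurable_good_event.
have d1 th' : `|th' - th| < rho ->
    is_derive th' (delta_mx ord0 b) (fun th' => Qpop th' (g0 S))
      (\int[Pr S]_(om in good_event)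
         (mom S (W S om) (dotv (index_vector (W S om)) th') (nuisance (W S om))
          * index_vector (W S om) ord0 b)).
  move=> thrho.
  have -> : (fun th' => Qpop th' (g0 S)) = (fun th' =>
      \int[Pr S]_(om in good_event) loss_at th' (g0 S) (W S om)).
    apply/funext => y; rewrite -integral_good_event; last exact: measurable_loss_at.
    by rewrite /Qpop unlock.
  have r0 : 0 < rho - `|th' - th| by rewrite subr_gt0.
  have inball y : `|y - th'| < rho - `|th' - th| -> `|y - th| < rho.
    rewrite ltrBrDr => yth; apply: le_lt_trans yth.
    by rewrite -[y - th](subrKA th') ler_normD.
  apply: (derive_integral (F := fun y om => loss_at y (g0 S) (W S om))
    (G := fun y om => mom S (W S om) (dotv (index_vector (W S om)) y)
      (nuisance (W S om)) * index_vector (W S om) ord0 b) (c := U * U) mB r0).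
    by move=> y /inball/close ye; exact: (loss_RV_integrable Bth He ye).
  move=> y om /inball/Tclose Ty Dom; split; first exact: loss_at_derive.
  rewrite normrM; apply: ler_pM => //.
    exact: (mom_le Ssetting Ssmooth Dom (Ty _ Dom)).
  exact: (index_vector_le Ssetting Ssmooth Dom).
have d2 := derive_integral (P := Pr S) (F := fun y om =>
    mom S (W S om) (dotv (index_vector (W S om)) y) (nuisance (W S om))
      * index_vector (W S om) ord0 b)
  (G := fun y om => hessian_entry y a b (W S om)) (x := th)
  (v := delta_mx ord0 a) (c := U ^+ 3) mB rho0.
have {}d2 := d2 (fun y yr => mom_RV_integrable b (Tclose y yr)).
have [|_ d2E] := d2.
  move=> y om yr Dom; have Ty := Tclose y yr _ Dom.
  split; first exact: (loss_at_derive2 Ssetting Ssmooth Dom a b Ty).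
  rewrite /hessian_entry !normrM 2!exprS expr1 mulrA.
  apply: ler_pM; rewrite ?mulr_ge0//.
    apply: ler_pM => //; first exact: (mom_dt_le Ssetting Ssmooth Dom Ty).
    exact: (index_vector_le Ssetting Ssmooth Dom).
  exact: (index_vector_le Ssetting Ssmooth Dom).
transitivity (\int[Pr S]_(om in good_event) hessian_entry th a b (W S om)).
  rewrite -d2E; apply: near_eq_derive.
  apply: filterS (near_dist_lt th rho0) => y; rewrite distrC => yr.
  by have [_ ->] := d1 y yr.
rewrite Rintegral_mkcond; apply: eq_Rintegral => om _.
rewrite /patch (_ : (om \in good_event) = (W S om \in D))//.
Qed.

End hessians.

(** * Tail of the Hessian deviation *)

Section deviation_lemmas.
Context d (Om : measurableType d) (R : realType) (P : probability Om R).
Context d' (E : measurableType d').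
Variables (n : nat) (W : {RV P >-> E}) (Ws : 'I_n -> {RV P >-> E}).

Lemma deviationB (f g : E -> R) (K : R) om :
  measurable_fun setT f -> measurable_fun setT g ->
  (forall w, `|f w| <= K) -> (forall w, `|g w| <= K) ->
  deviation W Ws (fun w => f w - g w) om = deviation W Ws f om - deviation W Ws g om.
Proof.
move=> mf mg fK gK; rewrite /deviation sumrB RintegralB//.
- by ring.
- exact: bounded_RV_integrable mf fK.
- exact: bounded_RV_integrable mg gK.
Qed.

Lemma deviation_le (f : E -> R) (c : R) om : (0 < n)%N ->
  measurable_fun setT f -> (forall w, `|f w| <= c) ->
  `|deviation W Ws f om| <= 2 * c.
Proof.
move=> n0 mf fc; rewrite /deviation.
apply: (le_trans (ler_normB _ _)); rewrite mulr_natl mulr2n; apply: lerD.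
  rewrite normrM ger0_norm ?invr_ge0// ler_pdivrMl ?ltr0n//.
  apply: (le_trans (ler_norm_sum _ _ _)).
  apply: (@le_trans _ _ (\sum_(k < n) c)); first exact: ler_sum.
  by rewrite sumr_const card_ord mulr_natl.
apply: (le_trans (le_normr_Rintegral _ _)) => //.
  exact: bounded_RV_integrable mf fc.
have -> : c = \int[P]_om' c.
  by rewrite Rintegral_cst// (congr1 fine (probability_setT P)) mulr1.
apply: le_Rintegral => //.
- apply: (@bounded_RV_integrable _ _ _ _ _ _ (fun w => `|f w|) c W).
    exact: measurableT_comp.
  by move=> w; rewrite normr_id.
- exact: finite_measure_integrable_cst.
Qed.

End deviation_lemmas.

Lemma norm_gt_close (R : realType) (x y s : R) : `|x - y| < `|x| - s -> s < `|y|.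
Proof.
have : `|x| <= `|x - y| + `|y| by rewrite -{1}(subrK y x) ler_normD.
by move: (`|x|) (`|x - y|) (`|y|) => a b c; lra.
Qed.

Section tail.
Variables (R : realType) (n : nat) (S : setting R n) (U : R).
Hypotheses (Ssetting : single_index_setting S) (Sdomain : index_domain S)
  (Sregular : regular_setting S) (Sp : (2 <= dimp S)%N)
  (Ssmooth : smooth_bounded_design S U) (n0 : (0 < n)%N).

Local Notation p := (dimp S).
Local Notation rW := 'rV[R]_(dimW S).
Local Notation D := (@design_support R n S).
Local Notation th0 := (theta0 S).
Local Notation h th a b := (hessian_entry th a b \_ D : borel_rV R (dimW S) -> R).

Lemma theta0_BTheta : BTheta th0.
Proof.
split; last by case: Ssetting => -[].
exists 0, 0; split; first by rewrite lexx ltr01.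
  have r0 T : l1norm (restrict_coords T (0 : 'rV[R]_p)) = 0.
    by rewrite /l1norm big1// => j _; rewrite !mxE if_same normr0.
  by rewrite /cone /= !r0 mulr0.
by rewrite scaler0 addr0.
Qed.

Lemma design_bound_ge0 : 0 <= U.
Proof.
case: (Ssmooth) => U1 _ _; case: theta0_BTheta => _ /U1; apply: le_trans.
by apply: sumr_ge0.
Qed.

(** If theta0 has nonzero entries, the bound 2 U coming from the parameter space
    is at most 2 k U; if theta0 = 0, the cone is reduced to 0, which keeps the
    bound proportional to k. *)
Lemma l1norm_BTheta th : BTheta th ->
  l1norm (th - th0) <= 2 * (sparsity S)%:R * U.
Proof.
move=> Bth; have U0 := design_bound_ge0.
have [k0|k0] := posnP (sparsity S).
  case: Bth => -[r [nu [_ nuT ->]]] _.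
  have T0 : nonzero_coords th0 = finset.set0 by apply/eqP; rewrite -cards_eq0; exact/eqP.
  move: nuT; rewrite /cone /= T0.
  rewrite (_ : restrict_coords finset.set0 nu = 0); last first.
    by apply/rowP => j; rewrite !mxE inE.
  rewrite (_ : restrict_coords _ nu = nu); last first.
    by apply/rowP => j; rewrite !mxE !inE.
  rewrite [l1norm 0](_ : _ = 0); last first.
    by rewrite /l1norm big1// => j _; rewrite mxE normr0.
  rewrite k0 !mulr0 mul0r => nu0.
  rewrite addrC addKr /l1norm (eq_bigr (fun j => `|r| * `|nu ord0 j|)).
    by rewrite -mulr_sumr; apply: mulr_ge0_le0.
  by move=> j _; rewrite mxE normrM.
have B2 : l1norm (th - th0) <= l1norm th + l1norm th0.
  rewrite /l1norm -big_split/=; apply: ler_sum => j _.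
  by rewrite !mxE; exact: ler_normB.
apply: (le_trans B2).
case: (Ssmooth) => U1 _ _.
have := U1 _ Bth.2; have := U1 _ theta0_BTheta.2.
have : 1 <= (sparsity S)%:R :> R by rewrite ler1n.
move: (sparsity S)%:R => k k1 b0 b1.
have : U <= k * U by rewrite ler_peMl.
lra.
Qed.

Lemma hessian_entry_restrict_le th a b : BTheta th -> forall w, `|(h th a b) w| <= U ^+ 3.
Proof.
move=> Bth w; rewrite /patch; case: ifPn => [/set_mem Dw|_].
  exact: hessian_entry_le.
by rewrite normr0 exprn_ge0// design_bound_ge0.
Qed.

Lemma hessian_entry_restrict_lipschitz th th' a b : BTheta th -> BTheta th' ->
  forall w, `|(h th a b) w - (h th' a b) w| <=
  `|\sum_j (U ^+ 3 * (th - th') ord0 j)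
           * (if w \in D then index_vector w ord0 j else 0)|.
Proof.
move=> Bth Bth' w; rewrite /patch; case: ifPn => [/set_mem Dw|_]; last first.
  by rewrite subrr normr0.
apply: (le_trans (hessian_entry_lipschitz Ssetting Sdomain Ssmooth Dw a b Bth Bth')).
rewrite -[X in X * _](ger0_norm (exprn_ge0 3 design_bound_ge0)) -normrM /dotv mulr_sumr.
rewrite le_eqVlt; apply/orP; left; apply/eqP; congr (`| _ |).
by apply: eq_bigr => j _; rewrite mulrCA mulrC.
Qed.

(** The null event outside of which both Hessians are given by
    [hessian_entry]. *)
Definition off_support : set (Om S) :=
  \bigcup_(i in [set: 'I_n]) (Ws S i @^-1` (~` D)).

Lemma measurable_off_support : measurable off_support.
Proof.
apply: fin_bigcup_measurable => // i _; apply: measurable_RV_preimage; apply: measurableC.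
exact: (measurable_design_support Ssetting Sregular).
Qed.

Lemma off_support_negligible : Pr S off_support = 0%E.
Proof.
have mD := @measurable_design_support R n S Ssetting Sregular.
apply/eqP; rewrite eq_le measure_ge0 andbT.
have -> : off_support = \big[setU/set0]_(i < n) (Ws S i @^-1` (~` D)).
  by rewrite bigsetU_bigcup_finType.
apply: le_trans (measure_bigsetU_le _ _ _) _.
  by move=> i _; apply: measurable_RV_preimage; exact: measurableC.
rewrite big1// => i _; case: (Ssetting) => -[_ [same _] _ _] _ _ _.
apply: etrans (design_support_full Ssetting Sregular).
exact: same i _ (measurableC mD).
Qed.

Lemma hessian_deviation_gt om (x : R) : 0 <= x -> ~ off_support om ->
  (x%:E < `|hessian_deviation om|)%E ->
  exists th a b, BTheta th /\ x < `|deviation (W S) (Ws S) (h th a b) om|.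
Proof.
move=> x0 offom.
have Dom i : D (Ws S i om).
  by apply: contrapT => nD; apply: offom; exists i.
have dev0 : (0 <= hessian_deviation om)%E.
  apply: le_trans (ereal_sup_ubound _); last by exists th0; first exact: theta0_BTheta.
  by rewrite lee_fin.
rewrite gee0_abs// => /ereal_sup_gt[_ [th Bth <-]]; rewrite lte_fin => xH.
suff [a [b xab]] : exists a b, x <
    `|(hessian (fun th' => Qhat om th' (g0 S)) th
       - hessian (fun th' => Qpop th' (g0 S)) th) a b|.
  exists th, a, b; split => //; move: xab.
  have subE (A B : 'M[R]_p) : (A - B) a b = A a b - B a b by rewrite !mxE.
  rewrite subE.
  suff -> : deviation (W S) (Ws S) (h th a b) om =
      hessian (fun th' => Qhat om th' (g0 S)) th a b
      - hessian (fun th' => Qpop th' (g0 S)) th a b by [].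
  congr (_ - _); last exact/esym/(hessian_Qpop Ssetting Sdomain Sregular Ssmooth).
  apply: etrans (esym (hessian_Qhat Ssetting Sdomain Ssmooth a b Dom Bth)).
  by congr (_ * _); apply: eq_bigr => i _; rewrite /patch mem_set.
apply: contrapT => nab; move: xH; apply/negP; rewrite -leNgt.
rewrite [`|_ - _|]mx_normrE; apply: bigmax_le => // -[a b] _ /=.
by rewrite leNgt; apply/negP => xab; apply: nab; exists a, b.
Qed.

Section union_bound.
Variable t : R.
Hypothesis t0 : 0 < t.

Let K := 2 * (sparsity S)%:R * U ^+ 5 + U ^+ 3.

Hypothesis U_gt0 : 0 < U.

Let bound := 4 * p%:R * expR (- (n%:R * t ^+ 2 / (32 * K ^+ 2))).

Let kU5_ge0 : 0 <= 2 * (sparsity S)%:R * U ^+ 5.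
Proof. by apply: mulr_ge0 => //; apply: exprn_ge0; exact: ltW. Qed.

Let U3_ge0 : 0 <= U ^+ 3. Proof. by apply: exprn_ge0; exact: ltW. Qed.

Let K_gt0 : 0 < K.
Proof. by apply: ltr_wpDl => //; exact: exprn_gt0. Qed.

Let iid : iid_copies (W S) (Ws S).
Proof. by case: Ssetting => -[]. Qed.

(** The increments from theta0 are dominated by the linear process with
    coefficients U^3 (th - theta0), so that B V = 2 k U^5. *)
Lemma increment_deviation (s : nat -> 'rV[R]_p) a b : (forall i, BTheta (s i)) ->
  (Pr S (\bigcup_i [set om | (2 * t < `|deviation (W S) (Ws S)
      (fun w => h (s i) a b w - h th0 a b w) om|)%R]) <= bound%:E)%E.
Proof.
move=> Bs; have B0 := theta0_BTheta.
pose v w j : R := if w \in D then index_vector w ord0 j else 0.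
pose x i j : R := U ^+ 3 * (s i - th0) ord0 j.
apply: (@uniform_deviation _ _ _ _ _ _ n (W S) (Ws S) iid p v
  (U ^+ 3 * (2 * (sparsity S)%:R * U)) U K t _ _ _ K_gt0 t0 n0 _
  (fun i w => h (s i) a b w - h th0 a b w) x).
- move=> w j; rewrite /v; case: ifPn => [/set_mem Dw|_].
    exact: (index_vector_le Ssetting Ssmooth Dw).
  by rewrite normr0 ltW.
- by apply: mulr_ge0 => //; apply: mulr_ge0 => //; exact: ltW.
- rewrite /K (_ : U ^+ 3 * _ * U = 2 * (sparsity S)%:R * U ^+ 5); last by ring.
  by rewrite lerDl.
- exact: leq_trans Sp.
- move=> i; apply: measurable_funB.
    exact: (measurable_hessian_entry Ssetting Sdomain Sregular Ssmooth).
  exact: (measurable_hessian_entry Ssetting Sdomain Sregular Ssmooth).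
- move=> i; rewrite /x; under eq_bigr do rewrite normrM.
  rewrite -mulr_sumr (ger0_norm U3_ge0).
  by apply: ler_wpM2l => //; exact: l1norm_BTheta.
- by move=> i w; exact: hessian_entry_restrict_lipschitz.
- move=> i i' w; rewrite -sumrB.
  rewrite [X in `|X| <= _](_ : _ = h (s i) a b w - h (s i') a b w); last by ring.
  have := hessian_entry_restrict_lipschitz a b (Bs i) (Bs i') w.
  rewrite (eq_bigr (fun j => x i j * v w j - x i' j * v w j))// => j _.
  by rewrite /x /v -mulrBl -mulrBr; congr (_ * _ * _); rewrite !mxE; ring.
Qed.

(** At theta0 alone the dominating process is the constant U^3, viewed as a
    linear form in one variable. *)
Lemma center_deviation a b :
  (Pr S [set om | (2 * t < `|deviation (W S) (Ws S) (h th0 a b) om|)%R]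
   <= bound%:E)%E.
Proof.
have B0 := theta0_BTheta.
have K3 : 1 * U ^+ 3 <= K.
  by rewrite mul1r /K lerDr.
rewrite -[X in Pr S X](@bigcup_const _ nat setT); last by exists 0%N.
apply: (@le_trans _ _
  (4 * 1%:R * expR (- (n%:R * t ^+ 2 / (32 * K ^+ 2))))%:E); last first.
  rewrite lee_fin /bound ler_wpM2r ?expR_ge0// mulr1 ler_peMr// ler1n.
  exact: leq_trans Sp.
apply: (@uniform_deviation _ _ _ _ _ _ n (W S) (Ws S) iid 1 (fun _ _ => U ^+ 3)
  1 (U ^+ 3) K t _ ler01 K3 K_gt0 t0 n0 (ltn0Sn 0) (fun _ => h th0 a b)
  (fun _ _ => 1)).
- by move=> w j; rewrite ger0_norm.
- by move=> i; exact: (measurable_hessian_entry Ssetting Sdomain Sregular Ssmooth).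
- by move=> i; rewrite big_ord1 normr1.
- by move=> i w; rewrite big_ord1 mul1r (ger0_norm U3_ge0); exact: hessian_entry_restrict_le.
- by move=> i i' w; rewrite subrr normr0.
Qed.

(** If the deviation exceeds 4 t at some th, it does so at a point of a dense
    sequence of B, the deviation being Lipschitz in th; then the increment from
    theta0 or the value at theta0 exceeds 2 t. *)
Lemma hessian_deviation_tail :
  (mu_ext (Pr S) [set om | (4 * t)%:E < `|hessian_deviation om|]
   <= ((p ^ 2)%:R * (2 * bound))%:E)%E.
Proof.
have B0 := theta0_BTheta.
have [s [Bs sdense]] := dense_sequence (ex_intro _ _ B0).
pose E1 a b := \bigcup_i [set om | (2 * t < `|deviation (W S) (Ws S)
      (fun w => h (s i) a b w - h th0 a b w) om|)%R].
pose E2 a b := [set om | (2 * t < `|deviation (W S) (Ws S) (h th0 a b) om|)%R].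
have mh th a b : BTheta th -> measurable_fun setT (h th a b).
  exact: (measurable_hessian_entry Ssetting Sdomain Sregular Ssmooth).
have mE1 a b : measurable (E1 a b).
  apply: bigcupT_measurable => i; apply: measurable_deviation_gt.
  by apply: measurable_funB; exact: mh.
have mE2 a b : measurable (E2 a b) by apply: measurable_deviation_gt; exact: mh.
pose F (ab : 'I_p * 'I_p) := E1 ab.1 ab.2 `|` E2 ab.1 ab.2.
have mF ab : measurable (F ab) by exact: measurableU.
pose G := off_support `|` \big[setU/set0]_(ab : 'I_p * 'I_p) F ab.
have mbigF : measurable (\big[setU/set0]_(ab : 'I_p * 'I_p) F ab).
  exact: measurable_bigsetU.
have mG : measurable G by apply: measurableU => //; exact: measurable_off_support.
apply: (@le_trans _ _ (mu_ext (Pr S) G)).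
  apply: le_mu_ext => om /= dev.
  have [|offom] := pselect (off_support om); first by left.
  right; have x0 : 0 <= 4 * t by rewrite mulr_ge0// ltW.
  have [th [a [b [Bth xdev]]]] := hessian_deviation_gt x0 offom dev.
  have [i close] : exists i, 4 * t < `|deviation (W S) (Ws S) (h (s i) a b) om|.
    pose gap := `|deviation (W S) (Ws S) (h th a b) om| - 4 * t.
    have gap0 : 0 < gap by rewrite subr_gt0.
    pose c := U ^+ 3 * (U * p%:R).
    have p0 : 0 < p%:R :> R by rewrite ltr0n (leq_trans _ Sp).
    have c0 : 0 < c by rewrite !mulr_gt0// exprn_gt0.
    have [i thi] := sdense th Bth (gap / (2 * c)) (divr_gt0 gap0 (mulr_gt0 (ltr0Sn _ 1) c0)).
    exists i.
    have hclose w : `|h th a b w - h (s i) a b w| <= c * `|th - s i|.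
      apply: (le_trans (hessian_entry_restrict_lipschitz a b Bth (Bs i) w)).
      have vU j : `|if w \in D then index_vector w ord0 j else 0| <= U.
        case: ifPn => [/set_mem Dw|_]; last by rewrite normr0 ltW.
        exact: (index_vector_le Ssetting Ssmooth Dw).
      apply: (le_trans (ler_norm_sum _ _ _)).
      apply: (@le_trans _ _ (\sum_j U ^+ 3 * U * `|(th - s i) ord0 j|)).
        apply: ler_sum => j _.
        rewrite 2!normrM (ger0_norm U3_ge0) mulrAC.
        by apply: ler_wpM2r => //; apply: ler_wpM2l.
      rewrite -mulr_sumr /c; move: (U ^+ 3) U3_ge0 => U3 U3_0; rewrite -!mulrA.
      apply: ler_wpM2l => //.
      by apply: ler_wpM2l; [exact: ltW|exact: l1norm_le_norm].
    have := deviation_le (W S) (Ws S) om n0 _ hclose.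
    rewrite (deviationB _ _ om (mh _ _ _ Bth) (mh _ _ _ (Bs i))
      (hessian_entry_restrict_le a b Bth) (hessian_entry_restrict_le a b (Bs i))).
    move=> /(_ (measurable_funB (mh _ _ _ Bth) (mh _ _ _ (Bs i)))) dd.
    apply: norm_gt_close; apply: (le_lt_trans dd).
    by rewrite mulrA mulrC -ltr_pdivlMr// mulr_gt0.
  rewrite bigsetU_bigcup_finType; exists (a, b) => //.
  have [?|small] := ltP (2 * t) `|deviation (W S) (Ws S) (h th0 a b) om|.
    by right.
  left; exists i => //=.
  rewrite (deviationB _ _ om (mh _ _ _ (Bs i)) (mh _ _ _ B0)
      (hessian_entry_restrict_le a b (Bs i)) (hessian_entry_restrict_le a b B0)).
  apply: (norm_gt_close (x := deviation (W S) (Ws S) (h (s i) a b) om)).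
  rewrite opprB addrC subrK; apply: (le_lt_trans small).
  by rewrite ltrBrDr (_ : 2 * t + 2 * t = 4 * t)//; ring.
rewrite measurable_mu_extE//.
apply: (le_trans (measureU2 (Pr S) measurable_off_support mbigF)).
rewrite [X in (X + _)%E](_ : _ = 0%E) ?add0e; last exact: off_support_negligible.
apply: (le_trans (measure_bigsetU_le (Pr S) (index_enum _) (fun ab _ => mF ab))).
apply: (@le_trans _ _ (\sum_(ab : 'I_p * 'I_p) (2 * bound)%:E)%E).
  apply: lee_sum => ab _.
  apply: (le_trans (measureU2 (Pr S) (mE1 _ _) (mE2 _ _))).
  rewrite mulr_natl mulr2n EFinD; apply: leeD; first exact: increment_deviation.
  exact: center_deviation.
rewrite sumEFin sumr_const card_prod card_ord -[_ *+ (p * p)]mulr_natl.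
by rewrite mulnn.
Qed.

End union_bound.

(** When U = 0, the function [hessian_entry], bounded by U^3, vanishes. *)
Lemma hessian_deviation_tail0 : U = 0 ->
  (mu_ext (Pr S) [set om | 0 < `|hessian_deviation om|] <= 0)%E.
Proof.
move=> U0; apply: (@le_trans _ _ (mu_ext (Pr S) off_support)); last first.
  have mo := measurable_off_support.
  rewrite (measurable_mu_extE (Pr S) mo) le_eqVlt; apply/orP; left; apply/eqP.
  exact: off_support_negligible.
apply: le_mu_ext => om /= dev; apply: contrapT => offom.
have [th [a [b [Bth]]]] := hessian_deviation_gt (lexx 0) offom dev.
have mh := measurable_hessian_entry Ssetting Sdomain Sregular Ssmooth a b Bth.
have := deviation_le (W S) (Ws S) om n0 mh (hessian_entry_restrict_le a b Bth).
by rewrite U0 expr0n/= mulr0 => /le_lt_trans /[apply]; rewrite ltxx.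
Qed.

End tail.

(** * Rate of convergence *)

(** With t = M K s / 2 and s = sqrt (2 ln p / n), one has M tau = 4 t, and the
    exponent n t^2 / (32 K^2) is M^2 ln p / 64; the factor p^3 collects the p^2
    entries and the p coordinates. *)
Lemma hessian_deviation_tau_tail (R : realType) (n : nat) (S : setting R n) (U M : R) :
  single_index_setting S -> index_domain S -> regular_setting S ->
  (2 <= dimp S)%N -> smooth_bounded_design S U -> (0 < n)%N -> 0 < M ->
  (mu_ext (Pr S) [set om | (M * tau S U)%:E < `|hessian_deviation om|]
   <= (8 * expR ((3 - M ^+ 2 / 64) * ln (dimp S)%:R))%:E)%E.
Proof.
move=> Ss Sd Sr Sp Sb n0 M0.
have := design_bound_ge0 Ss Sb; rewrite le_eqVlt => /orP[/eqP U0|U0].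
  have -> : M * tau S U = 0 by rewrite /tau -U0 !expr0n/= !mulr0 !mul0r addr0 mulr0.
  apply: (le_trans (hessian_deviation_tail0 Ss Sd Sr Sb n0 (esym U0))).
  by rewrite lee_fin mulr_ge0// expR_ge0.
have p1 : 1 < (dimp S)%:R :> R by rewrite ltr1n.
have lnp : 0 < ln (dimp S)%:R :> R by rewrite ln_gt0.
pose s : R := Num.sqrt (2 * ln (dimp S)%:R / n%:R).
have arg0 : 0 < 2 * ln (dimp S)%:R / n%:R :> R.
  by rewrite divr_gt0 ?ltr0n// mulr_gt0.
have s0 : 0 < s by rewrite sqrtr_gt0.
pose K : R := 2 * (sparsity S)%:R * U ^+ 5 + U ^+ 3.
have K0 : 0 < K.
  apply: ltr_wpDl; last exact: exprn_gt0.
  by apply: mulr_ge0 => //; apply: exprn_ge0; exact: ltW.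
pose t := M * K * s / 2.
have t0 : 0 < t by rewrite divr_gt0// !mulr_gt0.
have tauE : M * tau S U = 4 * t by rewrite /tau -/s /t /K; field.
have := hessian_deviation_tail Ss Sd Sr Sp Sb n0 t0 U0.
rewrite -tauE => /le_trans; apply; rewrite lee_fin -/K.
have -> : n%:R * t ^+ 2 / (32 * K ^+ 2) = M ^+ 2 / 64 * ln (dimp S)%:R.
  rewrite /t !exprMn sqr_sqrtr ?ltW//.
  by field; rewrite lt0r_neq0//= pnatr_eq0 -lt0n.
rewrite mulrBl expRD natrX.
have -> : expR (3 * ln (dimp S)%:R) = (dimp S)%:R ^+ 3 :> R.
  by rewrite expRM_natl lnK// posrE; exact: lt_trans p1.
by rewrite le_eqVlt; apply/orP; left; apply/eqP; ring.
Qed.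

(** M = 8 sqrt (3 + L) turns the tail bound into 8 p^(- L), at most 8 * 2^(- L)
    since p >= 2, and L is chosen so that this is at most e. *)
Lemma hessian_deviation_bigO_P (R : realType) (S : forall n : nat, setting R n) (U : R) :
  (forall n, single_index_setting (S n)) -> (forall n, index_domain (S n)) ->
  (forall n, regular_setting (S n)) -> (forall n, (2 <= dimp (S n))%N) ->
  (forall n, smooth_bounded_design (S n) U) ->
  bigO_P (fun n => Pr (S n)) (fun n => @hessian_deviation R n (S n))
         (fun n => tau (S n) U).
Proof.
move=> Ss Sd Sr Sp Sb e e0.
have ln2 : 0 < ln 2 :> R by rewrite ln_gt0// ltr1n.
pose L : R := Num.max 0 (ln (8 / e) / ln 2).
have L0 : 0 <= L by rewrite le_max lexx.
have e8 : 0 < 8 / e by rewrite divr_gt0.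
have Lln : ln (8 / e) <= L * ln 2.
  by rewrite -ler_pdivrMr// le_max lexx orbT.
have L3 : 0 < 3 + L by rewrite ltr_pwDl.
exists (8 * Num.sqrt (3 + L)); first by rewrite mulr_gt0// sqrtr_gt0.
exists 1%N => // n /= n0.
apply: (le_trans (hessian_deviation_tau_tail (Ss n) (Sd n) (Sr n) (Sp n) (Sb n) n0 _)).
  by rewrite mulr_gt0// sqrtr_gt0.
rewrite lee_fin exprMn sqr_sqrtr ?(ltW L3)//.
have -> : 3 - 8 ^+ 2 * (3 + L) / 64 = - L by field.
have lnp : ln 2 <= ln (dimp (S n))%:R :> R.
  by rewrite ler_ln ?posrE// ?ltr0n ?ler_nat// (leq_trans _ (Sp n)).
apply: (@le_trans _ _ (8 * expR (- ln (8 / e)))).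
  rewrite ler_wpM2l// ler_expR mulNr lerN2; apply: (le_trans Lln).
  by rewrite ler_wpM2l.
by rewrite expRN lnK ?posrE// invf_div mulrCA divff ?mulr1// lt0r_neq0.
Qed.

Lemma bigO_P_littleo_P1 (R : realType) (d : nat -> measure_display)
    (Om : forall n, measurableType (d n)) (P : forall n, probability (Om n) R)
    (X : forall n, Om n -> \bar R) (a : nat -> R) :
  a @ \oo --> (0 : R) -> bigO_P P X a -> littleo_P1 P X.
Proof.
move=> a0 OP e e0.
pose f n := mu_ext (P n) [set om : Om n | (e%:E < `|X n om|)%E].
have f0 n : (0 <= f n)%E by exact: mu_ext_ge0.
have small r : 0 < r -> \forall n \near \oo, (f n <= r%:E)%E.
  move=> r0; have [M M0 HM] := OP r r0.
  have aM : \forall n \near \oo, M * a n <= e.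
    have eM : 0 < e / M by rewrite divr_gt0.
    have /cvgrPdist_le/(_ _ eM) := a0.
    apply: filterS => n; rewrite sub0r normrN => /(le_trans (ler_norm _)).
    by rewrite ler_pdivlMr// mulrC.
  apply: filterS2 HM aM => n fM an; apply: le_trans fM.
  by apply: le_mu_ext => om /=; apply: le_lt_trans; rewrite lee_fin.
have fin n r : (f n <= r%:E)%E -> f n \is a fin_num.
  by move=> fr; rewrite ge0_fin_numE ?f0//; exact: le_lt_trans fr (ltry r).
apply/fine_cvgP; split.
  by apply: filterS (small 1 ltr01) => n f1; exact: fin f1.
apply/cvgrPdist_le => r r0; apply: filterS (small r r0) => n fr.
rewrite /= sub0r normrN ger0_norm ?fine_ge0//; last exact: f0.
by rewrite -lee_fin fineK//; exact: fin fr.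
Qed.

Theorem lemma3p1 (R : realType) (S : forall n : nat, setting R n) (U : R)
    (Ssetting : forall n, single_index_setting (S n))
    (Sdomain : forall n, index_domain (S n))
    (Sregular : forall n, regular_setting (S n))
    (Sp : forall n, (2 <= dimp (S n))%N)
    (Ssmooth : forall n, smooth_bounded_design (S n) U)
    (tau0 : (fun n => tau (S n) U) @ \oo --> (0 : R)) :
  bigO_P (fun n => Pr (S n)) (fun n => @hessian_deviation R n (S n))
         (fun n => tau (S n) U)
  /\ littleo_P1 (fun n => Pr (S n)) (fun n => @hessian_deviation R n (S n)).
Proof.
have OP := hessian_deviation_bigO_P Ssetting Sdomain Sregular Sp Ssmooth.
by split => //; exact: bigO_P_littleo_P1 tau0 OP.
Qed.
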